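(* Let $G$ be a finite group. If $\mathrm{AD}(G)<\frac{61}{15}$, then $G$ is solvable.
   Context: For a finite group $G$, $\mathrm{Irr}(G)$ denotes the set of irreducible complex characters of $G$, and $d(\varphi)$ denotes the degree of a character $\varphi$. The Fourier anti-diagonal constant of $G$ is given by the formula $\mathrm{AD}(G)=\frac{1}{|G|}\sum_{\varphi\in\mathrm{Irr}(G)} d(\varphi)^3$ (this is known to equal the Fourier norm of the subset $\{(g,g^{-1}): g\in G\}$ of $G\times G$; the formula may be taken as the definition). *)

(* Defs.v *)
From HB Require Import structures.
From mathcomp Require Import all_boot all_order all_algebra.
From mathcomp Require Import all_fingroup all_solvable all_field all_character.

Set Implicit Arguments.
Unset Strict Implicit.
Unset Printing Implicit Defensive.

Import Order.TTheory GRing.Theory Num.Theory.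
Local Open Scope ring_scope.

(* The Fourier anti-diagonal constant of G. It is algC-valued because characters
   are; the order of algC only compares numbers with a real difference, and
   AD G is a positive rational, so comparing it with a rational is the usual
   comparison. *)
Definition AD (gT : finGroupType) (G : {group gT}) : algC :=
  #|G|%:R^-1 * \sum_(i : Iirr G) 'chi_i 1%g ^+ 3.

(* Main.v *)
Require Import Defs.
From HB Require Import structures.
From mathcomp Require Import all_boot all_order all_algebra.
From mathcomp Require Import all_fingroup all_solvable all_field all_character.
From mathcomp Require Import zify ring.

Set Implicit Arguments.
Unset Strict Implicit.
Unset Printing Implicit Defensive.

Import Order.TTheory GRing.Theory Num.Theory.
Local Open Scope ring_scope.

(** Under the Plancherel measure, which gives an irreducible character chi the
    mass chi(1)^2 / |G|, AD(G) is the mean degree.  With the defect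
    w(d) = (5 - d) d^2 for d <= 5 and w(d) = 0 for d > 5, one has
    d^3 >= 5 d^2 - w(d), hence AD(G) >= 5 - Phi(G) / |G|, where Phi(G) is the sum
    of w over the degrees of G.  So it is enough to prove that every nonsolvable
    G satisfies 15 Phi(G) <= 14 |G|.  Equality holds for A5, where
    Phi = 4 + 18 + 18 + 16 = 56.

    This is proved by induction on |G|.  Restriction to a subgroup H transports
    the Plancherel measure of G to that of H without increasing degrees, so
    Phi(G) / |G| <= Phi(H) / |H| (total_defect_sub), and in a minimal
    counterexample G every proper subgroup is solvable.  If R is a maximal normal
    subgroup, then S = G / R is simple and nonabelian.  AD itself does not descend
    to quotients: AD(SL(2,3)) = 9/4 while AD(A4) = 5/2.  The bound on Phi can
    still be pushed through a minimal normal subgroup N contained in R: since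
    G / N satisfies it, it must fail for the set X of characters that are
    nontrivial on N, relative to their mass W.  Clifford theory shows that such a
    character of degree at most 4 is scalar on N, so that N is central of prime
    order p, and determinants show that p divides all degrees in X; hence p is 2
    or 3 (central_layer).  When R = 1, X is the set of all irreducible characters.

    The main tool is an upper bound for small degrees coming from class sizes.
    For h outside R, column orthogonality bounds the sum over X of |chi(h)|^2 by
    W / m, where m is the size of the class of hR in S.  If A is a subgroup on
    which chi splits into linear characters, the sum of |chi(h)|^2 over the
    elements h of A outside R is at least |A| chi(1) - |A :&: R| chi(1)^2
    (sum_norm_outside).  Hence many characters of degree at most 4 force a small
    class in S.  By a theorem of Burnside, class sizes of S are not prime powers,
    so a class with at most 9 elements has exactly 6, and then S embeds in the
    symmetric group of degree 6.  Using cyclic subgroups and a Sylow 5-subgroup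
    for A, one finds that |S| is divisible only by 2, 3 and 5, that an element
    of order 5 generates its centralizer and has at most 17 conjugates, and finally
    that |S| = 60 (card_simple_small_class5).

    Three cases remain.  If R = 1, elements of order 5 give a linear inequality
    for the numbers of characters of degrees 1 to 4 that contradicts
    Phi(G) > 56 (defect_simple).  If p = 2, small degrees in X are even, and
    elements of order 3, with 20 conjugates in S, see each such character
    (defect_even).  If p = 3, small degrees in X equal 3, and one uses
    chi(h) - chi(h^2) for h of order 5: h is conjugate to its inverse but not to
    its square, so orthogonality bounds the sum of |chi(h) - chi(h^2)|^2, while a
    character of degree 3 contributes at least 15/4 (defect_three). *)

(** * Subgroups of small index and class sizes in simple groups *)

Section PermRep.
Local Open Scope nat_scope.
Local Open Scope group_scope.

Lemma index_astab_dvd_fact (gT : finGroupType) (G : {group gT}) (T : finType)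
    (to : {action gT &-> T}) (K : {set T}) :
  [acts G, on K | to] -> (#|G : 'C_G(K | to)| %| #|K|`!)%N.
Proof.
move=> actsGK; have nKG : actby_cond G K to by [].
pose f := actperm_morphism <[nKG]>.
have kerf : 'ker f = 'C_G(K | to).
  by rewrite ker_actperm astab_actby setIT.
rewrite -kerf -{1}(setIid G) -card_morphim -perm.card_Sym cardSg //.
apply/subsetP=> _ /morphimP[a _ Ga ->]; rewrite inE.
apply/subsetP=> x; rewrite inE; apply: contraR => notKx.
by rewrite /= actpermE /= /actby (negPf notKx).
Qed.

Lemma index_gcore_dvd_fact (gT : finGroupType) (G L : {group gT}) :
  L \subset G -> (#|G : gcore L G| %| #|G : L|`!)%N.
Proof.
move=> sLG; have := index_astab_dvd_fact (actsRs_rcosets L G).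
by rewrite astabRs_rcosets (setIidPr (subset_trans (gcore_sub _ _) sLG)).
Qed.

Lemma simple_card_dvd_fact (gT : finGroupType) (S L : {group gT}) :
  simple S -> L \proper S -> (#|S| %| #|S : L|`!)%N.
Proof.
move=> simS ltLS; have sLS := proper_sub ltLS.
have [_ minS] := simpleP _ simS.
have [|coreS|coreS] := minS [group of gcore L S].
- by rewrite gcore_normal.
- by have := index_gcore_dvd_fact sLS; rewrite (coreS : gcore L S = 1) indexg1.
- have := proper_subn ltLS; rewrite -(coreS : gcore L S = S).
  by rewrite gcore_sub.
Qed.

(** The quotient of G by the core of L embeds in the symmetric group of degree 4,
    so it has order 2^a 3^b and is solvable. *)
Lemma index_le4_full (gT : finGroupType) (G L : {group gT}) :
    (forall N : {group gT}, N <| G -> N \proper G -> solvable N) ->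
    ~~ solvable G -> L \subset G -> (#|G : L| <= 4)%N -> L :=: G.
Proof.
move=> solN nsolG sLG iL; apply/eqP; rewrite eqEsubset sLG /=.
have nsK : gcore L G <| G by rewrite gcore_normal.
have [eK|] := eqVproper (normal_sub nsK).
  by move: (gcore_sub L G); rewrite [gcore L G]eK.
move=> ltK; case/negP: nsolG; rewrite (series_sol nsK) (solN [group of gcore L G]) //=.
apply: Burnside_p_a_q_b; rewrite card_quotient ?normal_norm //.
have dv : (#|G : gcore L G| %| 24)%N.
  apply: dvdn_trans (index_gcore_dvd_fact sLG) _.
  by case: #|G : L| iL => [|[|[|[|[|]]]]].
have : all (fun n => (size (primes n) <= 2)%N) (divisors 24) by [].
by move/allP; apply; rewrite -dvdn_divisors.
Qed.

Lemma class_size_primes (gT : finGroupType) (S : {group gT}) (x : gT) :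
    simple S -> ~~ abelian S -> x \in S -> x != 1 ->
  (1 < size (primes #|x ^: S|))%N.
Proof.
move=> simS nabS Sx ntx; apply: (primes_class_simple_gt1 simS nabS).
by apply/setD1P; rewrite classG_eq1 ntx mem_classes.
Qed.

Lemma two_primes_le9 n : (n <= 9)%N -> (1 < size (primes n))%N -> n = 6%N.
Proof. by do 10!case: n => [|n] //. Qed.

Lemma two_primes_le17 n : (n <= 17)%N -> (1 < size (primes n))%N ->
  n \in [:: 6; 10; 12; 14; 15]%N.
Proof. by do 18!case: n => [|n] //. Qed.

End PermRep.

(** * Simple groups with unusually small classes *)

Section SmallClasses.
Local Open Scope nat_scope.
Local Open Scope group_scope.
Variables (gT : finGroupType) (S : {group gT}).
Hypotheses (simS : simple S) (nabS : ~~ abelian S).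

Let has_class6 := exists2 h, h \in S & #|h ^: S| = 6%N.

Lemma simple_nonabelian_nonsolvable : ~~ solvable S.
Proof.
by apply: contra nabS => /simple_sol_prime/(_ simS)/prime_cyclic/cyclic_abelian.
Qed.

Lemma normal_in_simple (N : {group gT}) : N <| S -> N :=: 1 \/ N :=: S.
Proof. by case/simpleP: simS => _; apply. Qed.

Lemma class6_card_dvd : has_class6 -> (#|S| %| 720)%N.
Proof.
case=> h Sh card6; apply: (dvdn_trans (@simple_card_dvd_fact _ S 'C_S[h]%G simS _)).
- rewrite properE subsetIl /=; apply/negP=> sSC.
  suff: #|h ^: S| = 1%N by rewrite card6.
  by rewrite -index_cent1; apply/eqP; rewrite indexg_eq1.
- by rewrite /= index_cent1 card6.
Qed.

(** Here S permutes faithfully the 6 elements of a class K, and x, having order 5,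
    acts as a 5-cycle with one fixed point.  Its centralizer respects that
    decomposition, so it acts regularly on the 5-cycle. *)
Lemma centralizer5_class6 x : has_class6 -> x \in S -> #[x] = 5 -> 'C_S[x] = <[x]>.
Proof.
case=> h Sh card6 Sx ox; set K := h ^: S.
have ntx : x != 1 by rewrite -order_gt1 ox.
have nKS : S \subset 'N(K) := class_norm h S.
have cK1 : 'C_S(K) = 1.
  have /normal_in_simple[//|eC] : 'C_S(K) <| S.
    rewrite /normal subsetIl normsI ?normG //.
    by rewrite (subset_trans nKS) // cent_norm.
  suff: #|h ^: S| = 1%N by rewrite card6.
  have sSC : S \subset 'C_S(K) by rewrite (eC : 'C_S(K) = S).
  rewrite -index_cent1; apply/eqP; rewrite indexg_eq1 (subset_trans sSC) //.
  apply: setIS; apply/subsetP=> a /centP caK; apply/cent1P.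
  exact: (caK h (class_refl S h)).
pose F := 'Fix_(K | 'J)(<[x]>).
have x5 : 5.-group <[x]> by rewrite /pgroup -orderE ox.
have actK : [acts <[x]>, on K | 'J].
  by rewrite astabsJ cycle_subG (subsetP nKS).
have Fmod := pgroup_fix_mod x5 actK; rewrite -/F card6 in Fmod.
have sFK : F \subset K by apply: subsetIl.
have inF k : (k \in F) = (k \in K) && (k \in 'C[x]).
  by rewrite inE afixJ cent_cycle.
have F1 : #|F| = 1%N.
  have := subset_leq_card sFK; rewrite card6.
  have small f : 6 = f %[mod 5] -> (f <= 6)%N -> f = 1%N \/ f = 6%N.
    by case: f => [|[|[|[|[|[|[|]]]]]]] //; auto.
  case/(small _ Fmod) => // cF; have eFK : F = K.
    by apply/eqP; rewrite eqEcard sFK card6 cF.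
  case/eqP: ntx; apply/set1gP; rewrite -cK1 inE Sx; apply/centP=> k Kk.
  by move: Kk; rewrite -eFK inF => /andP[_ /cent1P].
have [q eF] : exists q, F = [set q] by apply/cards1P; rewrite F1.
have [k /setDP[Kk notFk]] : exists k, k \in K :\: F.
  by apply/set0Pn; rewrite -card_gt0 cardsD (setIidPr sFK) card6 F1.
have x1D : <[x]> \subset 'C_S[x] by rewrite cycle_subG inE Sx cent1id.
apply/eqP; rewrite eq_sym eqEcard x1D -orderE ox /=.
have oxk : #|orbit 'J <[x]> k| = 5.
  have : (#|orbit 'J <[x]> k| %| 5)%N by rewrite -ox dvdn_orbit.
  rewrite (dvdn_divisors _ (isT : 0 < 5)%N) !inE => /orP[/eqP o1|/eqP //].
  case/negP: notFk; rewrite inF Kk; have /orbit1P/afixP/(_ x (cycle_id x)) := card_orbit1 o1.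
  by move/conjg_fixP/commgP/cent1P.
have sOK : orbit 'J <[x]> k \subset K by rewrite acts_sub_orbit.
have Fq : q \in F by rewrite eF set11.
have Kq : q \in K := subsetP sFK q Fq.
have eK : K = q |: orbit 'J <[x]> k.
  apply/esym/eqP; rewrite eqEcard subUset sub1set Kq sOK /= cardsU1 oxk card6.
  case: (boolP (q \in _)) => // /imsetP[y Xy /= qk].
  case/negP: notFk; have /setIP[_ /afixP fq] := Fq.
  by have /= := fq _ (groupVr Xy); rewrite {1}qk conjgK => ->.
have FD d k' : d \in 'C_S[x] -> k' \in F -> k' ^ d \in F.
  case/setIP=> Sd cxd; rewrite !inF => /andP[Kk' cxk'].
  by rewrite memJ_norm ?(subsetP nKS) // Kk' groupJ.
(* An element centralizing x and one point of the 5-cycle fixes all of K. *)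
have regD : 'C_('C_S[x])[k | 'J] = 1.
  apply/trivgP; rewrite -cK1; apply/subsetP=> d.
  case/setIP=> Dd; rewrite /= astab1J => ckd; have /setIP[Sd cxd] := Dd.
  rewrite inE Sd; apply/centP=> k'; rewrite eK => /setU1P[->|].
    have := FD d q Dd Fq; rewrite eF => /set1P/conjg_fixP/commgP.
    exact: commute_sym.
  case/imsetP=> y Xy /= ->; apply/cent1P; rewrite cent1C.
  have cyd : y \in 'C[d].
    by apply: subsetP Xy; rewrite cycle_subG cent1C.
  by rewrite groupJ // cent1C.
have := card_orbit_stab 'J 'C_S[x]%G k; rewrite regD cards1 muln1 => <-.
have : orbit 'J 'C_S[x] k \subset K :\: F.
  apply/subsetP=> _ /imsetP[d Dd /= ->]; have /setIP[Sd _] := Dd.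
  rewrite inE (memJ_norm k (subsetP nKS d Sd)) Kk andbT.
  by apply: contra notFk => /(FD _ _ (groupVr Dd)); rewrite conjgK.
by move/subset_leq_card; rewrite cardsD (setIidPr sFK) card6 F1.
Qed.

(** The three hypotheses below record what the presence of many characters of
    small degree says about S; see [class6_of_big_order],
    [class6_of_big_sylow5] and [small_class_order5]. *)
Hypothesis big_order : forall z, z \in S -> 7 <= #[z] -> has_class6.
Hypothesis big_sylow5 : 7 <= #|S|`_5 -> has_class6.
Hypothesis small_class5 : forall x, x \in S -> #[x] = 5 -> #|x ^: S| <= 17.

Lemma prime_dvd_le5 p : prime p -> p %| #|S| -> p \in [:: 2; 3; 5].
Proof.
move=> p_pr pS; have [x Sx ox] := Cauchy p_pr pS.
have [p7|] := leqP 7 p; last by case: p p_pr pS ox => [|[|[|[|[|[|[|[]]]]]]]].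
have /class6_card_dvd d720 : has_class6 by apply: big_order Sx _; rewrite ox.
have : p \in primes 720 by rewrite mem_primes p_pr (dvdn_trans pS d720).
by [].
Qed.

Lemma not_25_dvd_card : (25 %| #|S|) = false.
Proof.
apply/negP=> d25; have /class6_card_dvd d720 : has_class6.
  apply: big_sylow5; apply: (@leq_trans 25) => //.
  rewrite p_part -[25]/(5 ^ 2)%N leq_exp2l //.
  by rewrite -pfactor_dvdn.
by have := dvdn_trans d25 d720.
Qed.

(** Otherwise |S| would be of the form 2^a 3^b, against Burnside's theorem. *)
Lemma five_dvd_card : 5 %| #|S|.
Proof.
apply: contraR simple_nonabelian_nonsolvable => n5.
apply: Burnside_p_a_q_b; apply: (@uniq_leq_size _ _ [:: 2; 3]).
  exact: primes_uniq.
move=> p; rewrite mem_primes => /and3P[p_pr _ pS].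
have := prime_dvd_le5 p_pr pS; rewrite !inE.
by case/or3P=> /eqP ep; move: pS n5; rewrite ep // => ->.
Qed.

(** An element of prime order other than 5 commuting with x would produce one of
    order at least 10, and the Sylow 5-subgroups have order 5. *)
Lemma centralizer5 x : x \in S -> #[x] = 5 -> 'C_S[x] = <[x]>.
Proof.
move=> Sx ox; have sXC : <[x]> \subset 'C_S[x] by rewrite cycle_subG inE Sx cent1id.
have coprime_case p : prime p -> p != 5 -> p %| #|'C_S[x]| -> 'C_S[x] = <[x]>.
  move=> p_pr p5 pC; have [y /setIP[Sy cxy] oy] := Cauchy p_pr pC.
  apply: centralizer5_class6 => //; apply: (@big_order (x * y)); first exact: groupM.
  have cop : coprime #[x] #[y].
    by rewrite ox oy prime_coprime // dvdn_prime2 // eq_sym.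
  have cxy2 : commute x y by apply/cent1P; rewrite cent1C.
  rewrite orderM //.
  by rewrite ox oy (@leq_trans (5 * 2)%N) // leq_mul2l prime_gt1.
have [|n2] := boolP (2 %| #|'C_S[x]|).
  exact: (coprime_case 2 isT isT).
have [|n3] := boolP (3 %| #|'C_S[x]|).
  exact: (coprime_case 3 isT isT).
have C5 : 5.-group 'C_S[x].
  apply/pgroupP=> p p_pr pC; have pS := dvdn_trans pC (cardSg (subsetIl _ _)).
  have := prime_dvd_le5 p_pr pS; rewrite !inE.
  by case/or3P=> /eqP ep; rewrite ?ep //; [case/negP: n2 | case/negP: n3]; rewrite -ep.
apply/eqP; rewrite eq_sym eqEcard sXC -orderE ox (card_pgroup C5).
rewrite -[X in _ <= X]expn1 leq_exp2l //.
rewrite leqNgt -pfactor_dvdn //; apply/negP=> d25.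
by have := not_25_dvd_card; rewrite (dvdn_trans d25) // cardSg ?subsetIl.
Qed.

Lemma card_class5 x : x \in S -> #[x] = 5 -> #|S| = (5 * #|x ^: S|)%N.
Proof.
move=> Sx ox; rewrite -index_cent1 centralizer5 // -[5]ox orderE Lagrange //.
by rewrite cycle_subG.
Qed.

(** The class of an element of order 5 has |S| / 5 elements, which leaves the
    orders 30, 50, 60, 70 and 75.  Order 30 is impossible because the classes of
    elements of orders 5, 3 and 2 would have 6, 10 and 15 elements. *)
Lemma card_simple_small_class5 : #|S| = 60.
Proof.
have pr5 : prime 5 by [].
have [x Sx ox] := Cauchy pr5 five_dvd_card.
have ntx : x != 1 by rewrite -order_gt1 ox.
have cS := card_class5 Sx ox.
have := two_primes_le17 (small_class5 Sx ox) (class_size_primes simS nabS Sx ntx).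
have n25 := not_25_dvd_card; rewrite !inE.
case/or4P => [/eqP m|/eqP m|/eqP m|]; first 1 last.
- by rewrite cS m in n25.
- by rewrite cS m.
- case/orP=> /eqP m; last by rewrite cS m in n25.
  have : 7 \in [:: 2; 3; 5] by apply: prime_dvd_le5; rewrite // cS m.
  by [].
have {}cS : #|S| = 30%N by rewrite cS m.
have class_size p y : prime p -> y \in S -> #[y] = p ->
    1 < size (primes #|y ^: S|) /\ (#|y ^: S| * p)%N %| 30.
  move=> p_pr Sy oy; split.
    by apply: class_size_primes; rewrite -?order_gt1 ?oy ?prime_gt1.
  rewrite -cS -index_cent1 -[X in _ %| X](Lagrange (subcent1_sub y S)) mulnC.
  rewrite dvdn_pmul2r ?indexg_gt0 // -oy orderE cardSg //.
  by rewrite cycle_subG inE Sy cent1id.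
have d3 : 3 %| #|S| by rewrite cS.
have d2 : 2 %| #|S| by rewrite cS.
have [y Sy oy] := Cauchy (isT : prime 3) d3.
have [z Sz oz] := Cauchy (isT : prime 2) d2.
have [py dy] := class_size 3 y isT Sy oy; have [pz dz] := class_size 2 z isT Sz oz.
have cy : #|y ^: S| = 10.
  have : all (fun n => (1 < size (primes n)) && ((n * 3)%N %| 30) ==> (n == 10)) (iota 0 31).
    by [].
  move/allP/(_ #|y ^: S|); rewrite py dy mem_iota /= => H; apply/eqP/H.
  by rewrite ltnS (leq_trans (leq_pmulr _ (isT : 0 < 3))) // dvdn_leq.
have cz : #|z ^: S| = 15.
  have : all (fun n => (1 < size (primes n)) && ((n * 2)%N %| 30) ==> (n == 15)) (iota 0 31).
    by [].
  move/allP/(_ #|z ^: S|); rewrite pz dz mem_iota /= => H; apply/eqP/H.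
  by rewrite ltnS (leq_trans (leq_pmulr _ (isT : 0 < 2))) // dvdn_leq.
have := sum_card_class S; rewrite cS.
have neq u v : #|u ^: S| != #|v ^: S| -> u ^: S != v ^: S.
  by apply: contraNneq => ->.
rewrite (bigD1 (x ^: S)) ?mem_classes //= (bigD1 (y ^: S)) /=; last first.
  by rewrite mem_classes // neq // m cy.
rewrite (bigD1 (z ^: S)) /=; last by rewrite mem_classes // !neq ?m ?cy ?cz.
by rewrite m cy cz.
Qed.

End SmallClasses.

(** * Simple groups of order 60 *)

Section Order60.
Local Open Scope nat_scope.
Local Open Scope group_scope.
Variables (gT : finGroupType) (S : {group gT}).
Hypotheses (simS : simple S) (nabS : ~~ abelian S) (card60 : #|S| = 60).
Hypothesis cent5 : forall x, x \in S -> #[x] = 5 -> 'C_S[x] = <[x]>.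

Lemma dvd_class_cent y d : d %| #|'C_S[y]| -> (#|y ^: S| * d)%N %| 60.
Proof.
move=> dC; rewrite -card60 -index_cent1 -(Lagrange (subcent1_sub y S)) mulnC.
by rewrite dvdn_pmul2r // indexg_gt0.
Qed.

Lemma order_dvd_cent y z : z \in S -> commute y z -> #[z] %| #|'C_S[y]|.
Proof.
by move=> Sz cyz; rewrite orderE cardSg // cycle_subG inE Sz; apply/cent1P.
Qed.

(** The alternative, a class of 10 elements, gives an involution t commuting with an
    element of order 3 as well as with a Sylow 2-subgroup, so that the class of t
    would have 1 or 5 elements. *)
Lemma card_class3 y : y \in S -> #[y] = 3 -> #|y ^: S| = 20.
Proof.
move=> Sy oy; have nty : y != 1 by rewrite -order_gt1 oy.
have two := class_size_primes simS nabS Sy nty.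
have d3 : 3 %| #|'C_S[y]| by rewrite -oy order_dvd_cent.
have cl := dvd_class_cent d3.
have : (#|y ^: S| == 10) || (#|y ^: S| == 20).
  have : all (fun n => (1 < size (primes n)) && ((n * 3)%N %| 60) ==> (n == 10) || (n == 20))
             (iota 0 61) by [].
  move/allP/(_ #|y ^: S|); rewrite two cl mem_iota /=; apply.
  by rewrite ltnS (leq_trans (leq_pmulr _ (isT : 0 < 3))) // dvdn_leq.
case/orP=> /eqP // c10.
have d2 : 2 %| #|'C_S[y]|.
  have := Lagrange (subcent1_sub y S); rewrite index_cent1 c10 card60 => e.
  by rewrite -(@dvdn_pmul2r 10) // e.
have [t /setIP[St cyt] ot] := Cauchy (isT : prime 2) d2.
have ntt : t != 1 by rewrite -order_gt1 ot.
have p2t : 2.-group <[t]> by rewrite /pgroup -orderE ot.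
have sTS : <[t]> \subset S by rewrite cycle_subG.
have [P sylP tP] := Sylow_superset sTS p2t.
have cP : #|P| = 4 by rewrite (card_Hall sylP) card60 p_part.
have abP : abelian P by apply: (card_p2group_abelian (isT : prime 2)); rewrite cP.
have sPC : P \subset 'C_S[t].
  rewrite subsetI (pHall_sub sylP) sub_cent1.
  by apply: (subsetP abP); rewrite -cycle_subG.
have d12 : 12 %| #|'C_S[t]|.
  rewrite -[12]/(4 * 3)%N Gauss_dvd // -cP cardSg //= -oy.
  by rewrite order_dvd_cent //; apply/cent1P.
have clt := dvd_class_cent d12.
have := class_size_primes simS nabS St ntt.
move: clt; rewrite -[60]/(5 * 12)%N dvdn_pmul2r // (dvdn_divisors _ (isT : 0 < 5)).
by rewrite !inE => /orP[]/eqP->.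
Qed.

Lemma sylow5_normalizer x : x \in S -> #[x] = 5 -> #|'N_S(<[x]>)| = 10.
Proof.
move=> Sx ox; have sXS : <[x]> \subset S by rewrite cycle_subG.
have sylX : 5.-Sylow(S) <[x]>.
  by rewrite pHallE sXS -orderE ox card60 p_part.
have := card_Syl_mod S (isT : prime 5); rewrite (card_Syl sylX) => m5.
have d5 : 5 %| #|'N_S(<[x]>)|.
  by rewrite -ox orderE cardSg // subsetI sXS normG.
have ntX : <[x]> :!=: 1 by rewrite cycle_eq1 -order_gt1 ox.
have L := Lagrange (subsetIl S 'N(<[x]>)); rewrite card60 in L.
have i12 : #|S : 'N_S(<[x]>)| %| 12.
  by rewrite -(@dvdn_pmul2r 5) // -[(12 * 5)%N]/60 -L mulnC dvdn_pmul2r.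
have i6 : #|S : 'N_S(<[x]>)| \in [:: 1; 6]%N.
  have : all (fun n => (n %% 5 == 1%N) ==> (n \in [:: 1; 6]%N)) (divisors 12) by [].
  by move/allP/(_ _ _)/implyP; apply; rewrite -?dvdn_divisors ?m5.
move: i6 L; rewrite !inE => /orP[]/eqP iN; last first.
  by rewrite [#|S : _|]iN => L; apply/eqP; rewrite -(@eqn_pmul2r 6) // L.
have nX : <[x]> <| S.
  rewrite /normal sXS; move/eqP: iN; rewrite indexg_eq1 subsetI subxx //.
case: (normal_in_simple simS nX) => eX; first by rewrite eX eqxx in ntX.
by have := card60; rewrite -eX -orderE ox.
Qed.

(** The normalizer N of <[x]> has order 10.  An involution in N acts on <[x]>
    without centralizing it, hence by inversion; and x ^ g = x ^+ 2 would make g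
    act with order 4 on <[x]>, although g ^+ 10 = 1. *)
Lemma order5_inverted x : x \in S -> #[x] = 5 ->
  (exists2 g, g \in S & x ^ g = x^-1) /\ x ^+ 2 \notin x ^: S.
Proof.
move=> Sx ox; have cN := sylow5_normalizer Sx ox.
have expJ g j k : x ^ g = x ^+ j -> x ^ (g ^+ k) = x ^+ (j ^ k)%N.
  move=> xg; elim: k => [|k IH]; first by rewrite conjg1.
  by rewrite expgSr conjgM IH conjXg xg -expgM -expnS.
split.
  have d2 : 2 %| #|'N_S(<[x]>)| by rewrite cN.
  have [g /setIP[Sg Ng] og] := Cauchy (isT : prime 2) d2.
  exists g => //; have : x ^ g \in <[x]> by rewrite memJ_norm // cycle_id.
  case/cycleP=> j xg.
  have /eqP : x ^+ (j ^ 2)%N = x ^+ 1.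
    by rewrite -(expJ g j 2%N xg) -og expg_order conjg1.
  rewrite eq_expg_mod_order ox -modnXm => j2.
  have : (j %% 5 == 1%N) || (j %% 5 == 4).
    by case: (j %% 5) (ltn_pmod j (isT : 0 < 5)) j2 => [|[|[|[|[|]]]]].
  case/orP=> j5.
    have xgx : x ^ g = x.
      by rewrite xg; apply/eqP; rewrite -[X in _ == X]expg1 eq_expg_mod_order ox (eqP j5).
    have : g \in 'C_S[x] by rewrite inE Sg cent1C; apply/cent1P/commgP/conjg_fixP.
    rewrite cent5 // => /order_dvdG; rewrite -orderE ox og //.
  rewrite xg; apply/eqP; rewrite -(inj_eq (mulgI x)) mulgV -expgS -order_dvdn ox.
  by rewrite /dvdn -addn1 -modnDml (eqP j5).
apply/negP=> /imsetP[g Sg xg].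
have Ng : g \in 'N_S(<[x]>).
  by rewrite inE Sg -cycle_subG norms_cycle -xg mem_cycle.
have := expJ g 2%N 10%N (esym xg); rewrite -cN (expg_cardG Ng) conjg1 => e.
have : x ^+ 1 == x ^+ (2 ^ 10)%N by rewrite expg1 -cN -e.
by rewrite eq_expg_mod_order ox.
Qed.

End Order60.

(** * Degrees and their defect *)

Definition irrdeg (gT : finGroupType) (G : {group gT}) (i : Iirr G) : nat :=
  irr_degree (socle_of_Iirr i).

(** The truncated subtraction makes the defect vanish from degree 5 on. *)
Definition defect (d : nat) : nat := ((5 - d) * d ^ 2)%N.

Definition total_defect (gT : finGroupType) (G : {group gT}) : nat :=
  (\sum_(i : Iirr G) defect (irrdeg i))%N.

Lemma five_squares_le d : (5 * d ^ 2 <= d ^ 3 + defect d)%N.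
Proof.
have [ge5|] := leqP 5 d; last by case: d => [|[|[|[|[|d]]]]].
by rewrite [(d ^ 3)%N]expnS (leq_trans (leq_mul ge5 (leqnn _))) ?leq_addr.
Qed.

Section Degrees.
Variables (gT : finGroupType) (G : {group gT}).
Implicit Types (i : Iirr G) (A : {group gT}).

Lemma irrdegE i : 'chi_i 1%g = (irrdeg i)%:R.
Proof. exact: irr1_degree. Qed.

Lemma irrdeg_gt0 i : (0 < irrdeg i)%N.
Proof. by have := irr1_gt0 i; rewrite irrdegE ltr0n. Qed.

Lemma sum_irrdeg_sq : (\sum_(i : Iirr G) irrdeg i ^ 2)%N = #|G|.
Proof.
apply/eqP; rewrite -eqC_nat -irr_sum_square natr_sum; apply/eqP.
by apply: eq_bigr => i _; rewrite irrdegE natrX.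
Qed.

(** Since 61/15 = 5 - 14/15, this is [five_squares_le] summed over Irr(G). *)
Lemma AD_lt_total_defect : AD G < 61 / 15 -> (14 * #|G| < 15 * total_defect G)%N.
Proof.
have Gpos : 0 < #|G|%:R :> algC by rewrite ltr0n cardG_gt0.
rewrite /AD mulrC ltr_pdivrMr // => AD_lt.
have cubes : (5 * #|G| <= \sum_(i : Iirr G) irrdeg i ^ 3 + total_defect G)%N.
  rewrite -sum_irrdeg_sq big_distrr -big_split /=; apply: leq_sum => i _.
  exact: five_squares_le.
have : (\sum_(i : Iirr G) irrdeg i ^ 3)%:R < 61 / 15 * #|G|%:R :> algC.
  rewrite natr_sum; apply: le_lt_trans AD_lt.
  by rewrite (eq_bigr (fun i => 'chi_i 1%g ^+ 3)) // => i _; rewrite irrdegE natrX.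
rewrite mulrAC ltr_pdivlMr // -!natrM ltr_nat => lt.
lia.
Qed.

Lemma restriction_norm_sum A i : A \subset G ->
  \sum_(h in A) `|'chi_i h| ^+ 2 = #|A|%:R * '['Res[A] 'chi_i].
Proof.
move=> sAG; rewrite (@cfnormE _ _ A) ?cfun_onG // mulVKf ?neq0CG //.
by apply: eq_bigr => h Ah; rewrite cfResE.
Qed.

(** If the restriction is the sum of the linear characters lambda_j with
    multiplicities m_j, its norm is the sum of the m_j ^ 2 and its degree the sum
    of the m_j. *)
Lemma degree_le_restriction_norm A i : A \subset G ->
    (forall j, j \in irr_constt ('Res[A] 'chi_i) -> 'chi_j \is a linear_char) ->
  (irrdeg i)%:R <= '['Res[A] 'chi_i].
Proof.
move=> sAG lin; set phi := 'Res _.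
have Nphi : phi \is a character by rewrite cfRes_char ?irr_char.
rewrite -irrdegE -(cfRes1 A 'chi_i) -/phi {1}(cfun_sum_constt phi) sum_cfunE.
rewrite cfdot_sum_irr [leRHS](bigID (mem (irr_constt phi))) /= ler_wpDr //.
  by apply: sumr_ge0 => j _; rewrite -normCK exprn_ge0.
apply: ler_sum => j Cj; rewrite cfunE (lin_char1 (lin j Cj)) mulr1.
have /natrP[n Dn] := Cnat_cfdot_char_irr j Nphi.
by rewrite Dn conjC_nat -natrM ler_nat; case: n {Dn} => // n; rewrite leq_pmulr.
Qed.

(** The sum over A is |A| times the norm of the restriction, and each of the |B|
    discarded terms is at most chi(1) ^ 2. *)
Lemma sum_norm_outside A (B : {group gT}) i : A \subset G -> B \subset A ->
    (forall j, j \in irr_constt ('Res[A] 'chi_i) -> 'chi_j \is a linear_char) ->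
  #|A|%:R * (irrdeg i)%:R - #|B|%:R * (irrdeg i)%:R ^+ 2
    <= \sum_(h in A :\: B) `|'chi_i h| ^+ 2.
Proof.
move=> sAG sBA lin.
have := restriction_norm_sum i sAG; rewrite (big_setID B) /= (setIidPr sBA).
move=> eA; rewrite -[leRHS](addKr (\sum_(h in B) `|'chi_i h| ^+ 2)) eA [leRHS]addrC.
rewrite lerB //.
  by rewrite ler_wpM2l ?degree_le_restriction_norm.
rewrite -[#|B|%:R]/_ mulr_natl -sumr_const; apply: ler_sum => h Bh.
rewrite lerXn2r ?nnegrE ?normr_ge0 ?ler0n // -irrdegE.
exact: char1_ge_norm (irr_char i).
Qed.

End Degrees.

(** * Behaviour of the total defect under subgroups and quotients *)

Section Monotone.
Variables (gT : finGroupType) (G : {group gT}).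

(** The defect is f(d) d ^ 2 with f(d) = 5 - d nonincreasing, and a constituent of
    the restriction of chi has degree at most chi(1).  Writing one factor chi(1) as
    the sum of the degrees of these constituents and summing over chi first,
    Frobenius reciprocity turns the sum into one over Irr(H). *)
Lemma total_defect_sub (H : {group gT}) : H \subset G ->
  (total_defect G <= #|G : H|%g * total_defect H)%N.
Proof.
move=> sHG; rewrite -(ler_nat algC) natrM !natr_sum.
pose a (i : Iirr G) (j : Iirr H) := '['Res[H] 'chi_i, 'chi_j].
have Nres i : 'Res[H] 'chi[G]_i \is a character by rewrite cfRes_char ?irr_char.
have aN i j : a i j \in Num.nat by rewrite Cnat_cfdot_char_irr.
have sumj i : (irrdeg i)%:R = \sum_j a i j * (irrdeg j)%:R.
  rewrite -irrdegE -(cfRes1 H) {1}['Res _]cfun_sum_cfdot sum_cfunE.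
  by apply: eq_bigr => j _; rewrite cfunE irrdegE.
have sumi j : \sum_i a i j * (irrdeg i)%:R = #|G : H|%g%:R * (irrdeg j)%:R.
  rewrite -(irrdegE j) -(cfInd1 _ sHG) ['Ind _]cfun_sum_cfdot sum_cfunE.
  apply: eq_bigr => i _; rewrite cfunE irrdegE; congr (_ * _).
  by rewrite -Frobenius_reciprocity cfdotC_char ?irr_char.
pose f d : algC := (5 - d)%:R.
have defectE d : (defect d)%:R = f d * d%:R * d%:R.
  by rewrite /defect natrM natrX expr2 mulrA.
have le_f i j : f (irrdeg i) * a i j <= f (irrdeg j) * a i j.
  have [->|nz] := eqVneq (a i j) 0; first by rewrite !mulr0.
  rewrite ler_wpM2r ?natr_ge0 // ler_nat leq_sub2l // -(ler_nat algC) -!irrdegE.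
  by rewrite -(cfRes1 H 'chi_i) char1_ge_constt.
have -> : \sum_(i : Iirr G) (defect (irrdeg i))%:R
        = \sum_i \sum_j f (irrdeg i) * a i j * ((irrdeg i)%:R * (irrdeg j)%:R).
  apply: eq_bigr => i _; rewrite defectE [X in _ * X = _]sumj mulr_sumr.
  by apply: eq_bigr => j _; ring.
apply: (@le_trans _ _ (\sum_i \sum_j f (irrdeg j) * a i j * ((irrdeg i)%:R * (irrdeg j)%:R))).
  apply: ler_sum => i _; apply: ler_sum => j _.
  by rewrite ler_wpM2r ?le_f // -natrM ler0n.
rewrite exchange_big mulr_sumr /=; apply: ler_sum => j _.
rewrite defectE.
rewrite [leRHS](_ : _ = f (irrdeg j) * (irrdeg j)%:R * (#|G : H|%g%:R * (irrdeg j)%:R));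
  last by ring.
rewrite -sumi mulr_sumr; apply: ler_sum => i _.
by rewrite (_ : _ * _ = f (irrdeg j) * (irrdeg j)%:R * (a i j * (irrdeg i)%:R)) //; ring.
Qed.

End Monotone.

Lemma sum_norm_irr (gT : finGroupType) (G : {group gT}) (x : gT) : x \in G ->
  \sum_(i : Iirr G) `|'chi_i x| ^+ 2 = #|'C_G[x]%g|%:R.
Proof.
move=> Gx; have := second_orthogonality_relation x Gx; rewrite class_refl mulr1n => <-.
by apply: eq_bigr => i _; rewrite normCK.
Qed.

Section QuotientSplit.
Variables (gT : finGroupType) (G N : {group gT}).
Hypothesis nsNG : (N <| G)%g.

Lemma big_irr_quo (T : Type) (idx : T) (op : Monoid.com_law idx) (F : Iirr G -> T) :
  \big[op/idx]_(i | N \subset cfker 'chi_i) F i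
    = \big[op/idx]_(i : Iirr (G / N)%g) F (mod_Iirr i).
Proof.
rewrite (reindex _ (mod_Iirr_bij nsNG)) /=.
by apply: eq_bigl => i; rewrite mod_IirrE ?cfker_mod.
Qed.

Lemma irrdeg_mod (i : Iirr (G / N)%g) : irrdeg (mod_Iirr i) = irrdeg i.
Proof.
by apply/eqP; rewrite -eqC_nat -!irrdegE mod_IirrE // cfMod1.
Qed.

Lemma total_defect_split :
  total_defect G = (total_defect (G / N)%g
    + \sum_(i | ~~ (N \subset cfker 'chi[G]_i)) defect (irrdeg i))%N.
Proof.
rewrite /total_defect (bigID (fun i => N \subset cfker 'chi_i)) /= big_irr_quo.
by congr (_ + _)%N; apply: eq_bigr => i _; rewrite irrdeg_mod.
Qed.

Lemma sum_irrdeg_sq_split :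
  #|G| = (#|(G / N)%g| + \sum_(i | ~~ (N \subset cfker 'chi[G]_i)) irrdeg i ^ 2)%N.
Proof.
rewrite -sum_irrdeg_sq (bigID (fun i => N \subset cfker 'chi_i)) /= big_irr_quo.
by rewrite -(sum_irrdeg_sq (G / N)%g); congr (_ + _)%N; apply: eq_bigr => i _; rewrite irrdeg_mod.
Qed.

Lemma sum_norm_irr_split x : x \in G ->
  #|'C_G[x]%g|%:R = #|'C_(G / N)[coset N x]%g|%:R
    + \sum_(i | ~~ (N \subset cfker 'chi[G]_i)) `|'chi_i x| ^+ 2.
Proof.
move=> Gx; rewrite -sum_norm_irr // (bigID (fun i => N \subset cfker 'chi_i)) /=.
by rewrite -sum_norm_irr_quo // sum_norm_irr // mem_quotient.
Qed.

End QuotientSplit.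

(** * Column orthogonality and class sizes in a quotient *)

Section ClassBounds.
Local Open Scope group_scope.
Variables (gT : finGroupType) (G N R : {group gT}).
Hypotheses (nsNG : N <| G) (nsRG : R <| G) (sNR : N \subset R).

Lemma class_coset (h : gT) (K : {group gT}) : K <| G -> h \in G ->
  coset K h ^: (G / K) = coset K @: (h ^: G).
Proof.
move=> nsKG Gh; have nKG := subsetP (normal_norm nsKG).
apply/setP=> u; apply/imsetP/imsetP.
  case=> _ /morphimP[g Ng Gg ->] ->; exists (h ^ g); first by rewrite memJ_class.
  by rewrite morphJ // nKG.
case=> _ /imsetP[g Gg ->] ->; exists (coset K g); first exact: mem_quotient.
by rewrite morphJ // nKG.
Qed.

Lemma leq_class_coset (h : gT) : h \in G ->
  (#|coset R h ^: (G / R)| <= #|coset N h ^: (G / N)| <= #|h ^: G|)%N.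
Proof.
move=> Gh; rewrite !class_coset // leq_imset_card andbT.
have nNG := subsetP (normal_norm nsNG); have nRG := subsetP (normal_norm nsRG).
pose f (u : coset_of N) := coset R (repr u).
have -> : coset R @: (h ^: G) = f @: (coset N @: (h ^: G)).
  rewrite -[RHS]imset_comp; apply: (@eq_in_imset _ _ (coset R) (f \o coset N)) => u hu /=.
  have Gu : u \in G by apply: subsetP hu; rewrite class_subG.
  have Nu := nNG u Gu.
  have : repr (coset N u) \in N :* u by rewrite -val_coset // mem_repr_coset.
  by rewrite /f; case/rcosetP=> z Nz ->; rewrite mkerl ?ker_coset ?nRG // (subsetP sNR).
exact: leq_imset_card.
Qed.

Lemma leq_class_quotient (h : gT) : h \in G ->
  (#|coset R h ^: (G / R)| <= #|h ^: G|)%N.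
Proof. by move=> Gh; rewrite class_coset // leq_imset_card. Qed.
End ClassBounds.

Section Bounds2.
Variables (gT : finGroupType) (G N R : {group gT}).
Hypotheses (nsNG : (N <| G)%g) (nsRG : (R <| G)%g) (sNR : N \subset R).

Lemma sum_norm_irr_class (h : gT) : h \in G ->
  (\sum_(i : Iirr G) `|'chi_i h| ^+ 2) * #|(coset R h ^: (G / R))%g|%:R <= #|G|%:R.
Proof.
move=> Gh; rewrite sum_norm_irr // -natrM ler_nat.
rewrite -(Lagrange (subcent1_sub h G)) leq_mul2l index_cent1.
by rewrite (leq_class_quotient nsRG Gh) orbT.
Qed.

(** The left-hand sum is c - c', where c and c' are the orders of the centralizers
    of h in G and of its image in G / N.  If a and b are the sizes of the
    corresponding classes, then c a - c' b is the right-hand side, and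
    a >= b >= m, where m is the size of the class of h in G / R. *)
Lemma sum_norm_irr_class_diff (h : gT) : h \in G ->
  (\sum_(i | ~~ (N \subset cfker 'chi[G]_i)) `|'chi_i h| ^+ 2)
     * #|(coset R h ^: (G / R))%g|%:R
  <= (\sum_(i | ~~ (N \subset cfker 'chi[G]_i)) irrdeg i ^ 2)%N%:R.
Proof.
move=> Gh; set s := \sum_(i | _) `|_| ^+ 2; set m := #|_|.
have s_ge0 : 0 <= s by apply: sumr_ge0 => i _; rewrite exprn_ge0 ?normr_ge0.
have := sum_norm_irr_split nsNG Gh; rewrite -/s => cE.
have /andP[mb ba] := leq_class_coset nsNG nsRG sNR Gh.
have WE := sum_irrdeg_sq_split nsNG.
have Gq : coset N h \in (G / N)%g by apply: mem_quotient.
have cardG := Lagrange (subcent1_sub h G); rewrite index_cent1 in cardG.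
have cardQ := Lagrange (subcent1_sub (coset N h) (G / N)%g).
rewrite index_cent1 in cardQ.
rewrite -(lerD2l #|(G / N)%g|%:R) -natrD -WE -cardG -cardQ !natrM cE.
set b := #|(coset N h ^: _)%g| in mb ba cardQ *; set c := _%:R.
apply: (@le_trans _ _ ((c + s) * b%:R)); last first.
  by rewrite ler_wpM2l ?ler_nat // addr_ge0 // ler0n.
by rewrite mulrDl lerD2l ler_wpM2l ?ler_nat.
Qed.
End Bounds2.

(** * Many small degrees force small classes *)

Section Counting.
Variables (gT : finGroupType) (G R : {group gT}) (X : pred (Iirr G)) (W : nat).
Hypothesis nsRG : (R <| G)%g.
Hypothesis class_bound : forall h, h \in G ->
  (\sum_(i | X i) `|'chi_i h| ^+ 2) * #|(coset R h ^: (G / R))%g|%:R <= W%:R.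

(** Sum the squares |chi(h)| ^ 2 over the characters in X and the elements h of A
    outside R: the class sizes bound the result from above, and
    [sum_norm_outside] bounds it from below, character by character.  The set X
    is either the whole of Irr(G) or the set of the characters that are nontrivial on
    a given normal subgroup contained in R, and W is the sum of the squares of the
    degrees in X. *)
Lemma weighted_count (A : {group gT}) (q M : nat) :
    A \subset G -> (#|A| = q * #|A :&: R|)%N -> (4 < q)%N ->
    (forall i, X i -> (irrdeg i <= 4)%N ->
      forall j, j \in irr_constt ('Res[A] 'chi_i) -> 'chi_j \is a linear_char) ->
    (forall h, h \in A :\: R -> (M <= #|(coset R h ^: (G / R))%g|)%N) ->
  (M * \sum_(i | X i && (irrdeg i <= 4)) irrdeg i * (q - irrdeg i) <= q.-1 * W)%N.
Proof.
move=> sAG cA q_gt4 linA bigM; set B := (A :&: R)%G.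
have sBA : B \subset A by apply: subsetIl.
have posB : (0 < #|B|)%N by apply: cardG_gt0.
have dA : A :\: R = A :\: B by rewrite setDIr setDv set0U.
have cD : #|A :\: R| = (q.-1 * #|B|)%N.
  rewrite dA cardsD (setIidPr sBA) cA -[q in LHS]prednK 1?ltnW ?mulSn ?addKn //.
  exact: leq_trans q_gt4.
rewrite -(leq_pmul2r posB) -(ler_nat algC).
apply: (@le_trans _ _ (\sum_(h in A :\: R) W%:R)); last first.
  rewrite sumr_const cD -mulrnA ler_nat.
  by apply: eq_leq; lia.
apply: (@le_trans _ _ (\sum_(h in A :\: R) (\sum_(i | X i) `|'chi_i h| ^+ 2) * M%:R)).
  rewrite -mulr_suml exchange_big /= -mulnA natrM mulrC ler_wpM2r ?ler0n //.
  rewrite big_distrl natr_sum /= [leRHS](bigID (fun i => irrdeg i <= 4)%N) /= ler_wpDr //.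
    by apply: sumr_ge0 => i _; apply: sumr_ge0 => h _; rewrite exprn_ge0 ?normr_ge0.
  apply: ler_sum => i /andP[Xi d4].
  rewrite dA; apply: le_trans (sum_norm_outside sAG sBA (linA i Xi d4)).
  rewrite -natrX -!natrM cA -natrB ?ler_nat; last first.
    by rewrite expnS expn1 mulnA leq_mul2r mulnC leq_mul2r (leq_trans d4 (ltnW _)) ?orbT.
  apply: eq_leq; have dq : (irrdeg i <= q)%N by apply: leq_trans d4 (ltnW _).
  move: (irrdeg i) dq => d /subnKC {1 2}<-; move: (q - d)%N => k.
  by rewrite (_ : ((d + k) * _ * d)%N = #|A :&: R| * d ^ 2 + d * k * #|A :&: R|)%N ?addKn //; lia.
apply: ler_sum => h /[dup] ADh /setDP[Ah _].
apply: le_trans (class_bound (subsetP sAG h Ah)).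
rewrite ler_wpM2l ?ler_nat ?bigM //.
by apply: sumr_ge0 => i _; rewrite exprn_ge0 ?normr_ge0.
Qed.
End Counting.

Lemma small_defect_arith (k W m c P T : nat) : (0 < k)%N ->
    (m.+1 * T <= k * W)%N -> (k * P <= c * T)%N -> (15 * c <= 14 * m.+1)%N ->
  (15 * P <= 14 * W)%N.
Proof.
move=> k0 TW PT cm; rewrite -(@leq_pmul2l (k * m.+1)) ?muln_gt0 ?k0 //.
apply: (@leq_trans (15 * m.+1 * (c * T))).
  rewrite [leqLHS](_ : _ = 15 * m.+1 * (k * P))%N ?leq_mul2l ?PT ?orbT //.
  by clear; lia.
apply: (@leq_trans (15 * c * (k * W))).
  rewrite [leqLHS](_ : _ = 15 * c * (m.+1 * T))%N ?leq_mul2l ?TW ?orbT //.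
  by clear; lia.
rewrite [leqRHS](_ : _ = 14 * m.+1 * (k * W))%N ?leq_mul2r ?cm ?orbT //.
by clear; lia.
Qed.

Section SmallClassesInQuotient.
Variables (gT : finGroupType) (G R : {group gT}) (X : pred (Iirr G)) (W : nat).
Hypothesis nsRG : (R <| G)%g.
Hypothesis class_bound : forall h, h \in G ->
  (\sum_(i | X i) `|'chi_i h| ^+ 2) * #|(coset R h ^: (G / R))%g|%:R <= W%:R.
Hypotheses (simS : simple (G / R)) (nabS : ~~ abelian (G / R)).
Hypothesis big_defect : (14 * W < 15 * \sum_(i | X i) defect (irrdeg i))%N.

Lemma sum_defect_le4 :
  (\sum_(i | X i) defect (irrdeg i) = \sum_(i | X i && (irrdeg i <= 4)) defect (irrdeg i))%N.
Proof.
rewrite (bigID (fun i => irrdeg i <= 4)%N) /= [X in (_ + X)%N]big1 ?addn0 // => i.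
by rewrite -ltnNge /defect => /andP[_ /eqP->].
Qed.

(** With k = q - 1, P the sum of the defects and T the weighted sum of
    [weighted_count], the absence of a class of size at most m outside R gives
    (m + 1) T <= k W, and k P <= c T contradicts the size of the defect. *)
Lemma exists_small_class (A : {group gT}) (q c m : nat) :
    A \subset G -> (#|A| = q * #|A :&: R|)%N -> (4 < q)%N ->
    (forall i, X i -> (irrdeg i <= 4)%N ->
      forall j, j \in irr_constt ('Res[A] 'chi_i) -> 'chi_j \is a linear_char) ->
    (forall d, (0 < d <= 4)%N -> (q.-1 * defect d <= c * (d * (q - d)))%N) ->
    (15 * c <= 14 * m.+1)%N ->
  exists2 h, h \in A :\: R & (#|(coset R h ^: (G / R))%g| <= m)%N.
Proof.
move=> sAG cA q4 linA le_c le_m; apply/exists_inP; apply: contraT.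
rewrite negb_exists_in => /forall_inP no.
have bigM h : h \in A :\: R -> (m.+1 <= #|(coset R h ^: (G / R))%g|)%N.
  by move/no; rewrite -ltnNge.
have wc := weighted_count nsRG class_bound sAG cA q4 linA bigM.
have := big_defect; rewrite sum_defect_le4.
set Phi := (\sum_(i | _) defect _)%N; set T := (\sum_(i | _) _)%N in wc.
have le_Phi : (q.-1 * Phi <= c * T)%N.
  rewrite !big_distrr /=; apply: leq_sum => i /andP[_ d4].
  by rewrite le_c ?irrdeg_gt0.
have q1 : (0 < q.-1)%N by case: (q) q4 => [|[]].
by rewrite ltnNge (small_defect_arith q1 wc le_Phi le_m).
Qed.

Lemma coset_nontrivial h : h \in G -> h \notin R -> (coset R h != 1)%g.
Proof.
move=> Gh; apply: contra => /eqP; apply: coset_idr.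
exact: subsetP (normal_norm nsRG) h Gh.
Qed.

Let has_class6 := exists2 h, h \in (G / R)%g & #|(h ^: (G / R))%g| = 6%N.

Lemma class6_of_big_image (A : {group gT}) (q : nat) :
    A \subset G -> (#|A| = q * #|A :&: R|)%N -> (7 <= q)%N ->
    (forall i, X i -> (irrdeg i <= 4)%N ->
      forall j, j \in irr_constt ('Res[A] 'chi_i) -> 'chi_j \is a linear_char) ->
  has_class6.
Proof.
move=> sAG cA q7 linA.
(* For q >= 7 the defect is at most 9 / (q - 1) times d (q - d): d = 3 is the worst case. *)
have [||h /setDP[Ah nRh] c9] := @exists_small_class A q 9 9 sAG cA _ linA _ isT.
- exact: leq_trans q7.
- have {q7} [k ->] : exists k, q = (7 + k)%N by exists (q - 7)%N; rewrite subnKC.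
  by case=> [|[|[|[|[|d]]]]] // _; rewrite /defect /=; clear; lia.
have Gh := subsetP sAG h Ah; exists (coset R h); first exact: mem_quotient.
apply: two_primes_le9 c9 (class_size_primes simS nabS _ (coset_nontrivial Gh nRh)).
exact: mem_quotient.
Qed.

Lemma card_sub_image (A : {group gT}) : A \subset G ->
  #|A| = (#|(A / R)%g| * #|A :&: R|)%N.
Proof.
move=> sAG; rewrite card_quotient ?(subset_trans sAG) ?normal_norm //.
by rewrite -divgI divnK ?cardSg ?subsetIl.
Qed.

Lemma cyclic_linear (g : gT) (i : Iirr G) (j : Iirr <[g]>%g) :
  j \in irr_constt ('Res[<[g]>%g] 'chi_i) -> 'chi_j \is a linear_char.
Proof. by move=> _; rewrite irr_cyclic_lin ?cycle_cyclic. Qed.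

Lemma class6_of_big_order z : z \in (G / R)%g -> (7 <= #[z]%g)%N -> has_class6.
Proof.
case/morphimP=> g Ng Gg ->{z} big; have sAG : <[g]>%g \subset G by rewrite cycle_subG.
apply: (class6_of_big_image sAG (card_sub_image sAG)); last first.
  by move=> i _ _ j; apply: cyclic_linear.
by rewrite /= quotient_cycle.
Qed.

(** A 5-group has irreducible characters of degree a power of 5, so those of degree
    at most 4 are linear. *)
Lemma class6_of_big_sylow5 : (7 <= #|(G / R)%g|`_5)%N -> has_class6.
Proof.
have [P sylP] := Sylow_exists 5 G; have sPG := pHall_sub sylP.
have nRP : P \subset 'N(R)%g by rewrite (subset_trans sPG) ?normal_norm.
rewrite -(card_Hall (quotient_pHall nRP sylP)) => big.
apply: (class6_of_big_image sPG (card_sub_image sPG) big) => i _ d4 j Cj.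
rewrite qualifE /= irr_char irrdegE pnatr_eq1.
have jd : (irrdeg j <= 4)%N.
  apply: leq_trans d4; rewrite -(ler_nat algC) -!irrdegE -(cfRes1 P 'chi_i).
  by rewrite char1_ge_constt ?cfRes_char ?irr_char.
have : (irrdeg j %| #|P|)%N by have := dvd_irr1_cardG j; rewrite irrdegE dvdC_nat.
rewrite (card_Hall sylP) p_part => /dvdn_pfactor[//|e _ je].
move: jd; rewrite je; case: e {je} => // e; rewrite expnS => jd.
by move: jd (expn_gt0 5 e); clear; lia.
Qed.

Lemma small_class_order5 x : x \in (G / R)%g -> #[x]%g = 5%N ->
  (#|(x ^: (G / R))%g| <= 17)%N.
Proof.
move=> Sx ox; have [g Ng Gg xg] := morphimP Sx.
have sAG : <[g]>%g \subset G by rewrite cycle_subG.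
have cA := card_sub_image sAG; rewrite quotient_cycle // -xg -[#|<[x]>%g|]/#[x]%g ox in cA.
(* For q = 5 the defect is d (5 - d) times d, with d <= 4, and 16 = 4 (q - 1). *)
have [||h /setDP[Ah nRh] c17] := @exists_small_class <[g]>%G 5 16 17 sAG cA isT _ _ isT.
- by move=> i _ _ j; apply: cyclic_linear.
- by case=> [|[|[|[|[|d]]]]].
have Gh := subsetP sAG h Ah; apply: leq_trans c17.
have hx : coset R h \in <[x]>%g.
  by rewrite xg -quotient_cycle // mem_quotient.
have gen : <[coset R h]>%g = <[x]>%g.
  apply/eqP; rewrite eqEcard cycle_subG hx -!orderE ox.
  have : (#[coset R h]%g %| 5)%N by rewrite -ox order_dvdG.
  have : #[coset R h]%g != 1%N by rewrite order_eq1 coset_nontrivial.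
  by case: #[_]%g => [|[|[|[|[|[|[]]]]]]].
by rewrite -!index_cent1 -!cent_cycle gen.
Qed.

End SmallClassesInQuotient.

(** * Minimal normal subgroups and characters of small degree *)

Section CentralKernel.
Variables (gT : finGroupType) (G N : {group gT}) (p : nat).

Lemma perfect_linear_char (xi : 'CF(G)) :
  (G^`(1) = G)%g -> xi \is a linear_char -> {in G, forall x, xi x = 1}.
Proof.
move=> perfG lin_xi x Gx; have := lin_char_der1 lin_xi; rewrite perfG => /subsetP/(_ x Gx).
by move/cfker1; rewrite (lin_char1 lin_xi).
Qed.

(** On N, chi is chi(1) times a linear character lambda of order p, so the
    determinant of chi restricts to lambda ^+ chi(1); but G, being perfect, has no
    nontrivial linear character. *)
Lemma prime_dvd_degree (i : Iirr G) :
    (G^`(1) = G)%g -> N \subset ('Z(G))%g -> #|N| = p -> prime p ->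
    ~~ (N \subset cfker 'chi_i) ->
  (p %| irrdeg i)%N.
Proof.
move=> perfG sNZ cN p_pr nker.
have sNZi : N \subset ('Z('chi_i))%CF.
  by rewrite (subset_trans sNZ) // -cap_cfcenter_irr bigcap_inf.
have sNG : N \subset G by rewrite (subset_trans sNZ) ?subsetIl.
have [xi lin_xi resZ] := cfcenter_Res 'chi_i.
pose lam := 'Res[N] xi; have lin_lam : lam \is a linear_char by apply: cfRes_lin_char.
have resN : 'Res[N] 'chi_i = lam *+ irrdeg i.
  rewrite -(cfResRes _ sNZi) ?cfcenter_sub // resZ linearZ /=.
  by rewrite irrdegE scaler_nat.
have lamX : lam ^+ irrdeg i = 1.
  rewrite -(cfDet_id lin_lam) -cfDetMn ?lin_charW // -resN cfDetRes ?irr_char //.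
  apply/cfun_inP=> x Nx; rewrite cfResE // cfun1E Nx.
  by rewrite perfect_linear_char ?cfDet_lin_char ?(subsetP sNG).
have : (#[lam]%CF %| p)%N by rewrite -cN cforder_lin_char_dvdG.
case/primeP: p_pr => _ /[apply] /orP[/eqP o1|/eqP <-]; last by rewrite dvdn_cforder lamX.
case/negP: nker; apply/subsetP=> x Nx; rewrite cfkerEirr inE.
have lam1 : lam = 1 by rewrite -(expr1 lam) -o1 exp_cforder.
by rewrite -(cfResE _ sNG Nx) -(cfRes1 N) resN lam1 !muln_cfunE !cfun1E Nx group1.
Qed.

(** The constituents of the restriction of chi to N form one G-orbit, of at most
    chi(1) <= 4 linear characters.  The stabilizer of one of them has index at most 4
    in G, so it is G; thus N acts by scalars and [~: N, G] lies in the kernel of chi, which by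
    minimality meets N trivially. *)
Lemma minnormal_faithful_small_degree (i : Iirr G) :
    ~~ solvable G -> (forall H : {group gT}, H \proper G -> solvable H) ->
    minnormal N G -> N \proper G -> (irrdeg i <= 4)%N ->
    ~~ (N \subset cfker 'chi_i) ->
  N \subset ('Z(G))%g.
Proof.
move=> nsolG solP minN ltNG d4 nker; have sNG := proper_sub ltNG.
have [/andP[ntN nNG] min] := mingroupP minN.
have nsNG : (N <| G)%g by apply/andP.
have [_ _ /is_abelemP[q _ /abelem_abelian abN]] := minnormal_solvable minN (subxx _) (solP N ltNG).
have [j Cj] := constt_cfRes_irr N i.
have resE := Clifford_Res_sum_cfclass nsNG Cj.
have linj : 'chi_j \is a linear_char by apply/char_abelianP.
set c := '[_, _] in resE.
have IG : ('I_G['chi_j] = G)%g.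
  apply: (@index_le4_full _ G ('I_G['chi_j])%G) => //; last 1 first.
  - rewrite -size_cfclass; apply: leq_trans d4.
    have : (irrdeg i)%:R = c * (size ('chi_j ^: G)%CF)%:R.
      rewrite -irrdegE -(cfRes1 N) resE cfunE sum_cfunE; congr (_ * _).
      rewrite big_seq (eq_bigr (fun _ => 1)) => [|psi /cfclassP[y Gy ->]].
        by rewrite -big_seq big_const_seq count_predT iter_addr_0.
      by rewrite cfConjg1 lin_char1.
    have /natrP[n cn] : c \in Num.nat by rewrite Cnat_cfdot_char_irr ?cfRes_char ?irr_char.
    rewrite cn -natrM => /eqP; rewrite eqr_nat => /eqP e; rewrite e leq_pmull //.
    by move: (irrdeg_gt0 i); rewrite e; case: (n).
  - by move=> M _; apply: solP.
  - exact: subsetIl.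
have resE2 : 'Res[N] 'chi_i = c *: 'chi_j.
  rewrite resE cfclass_invariant ?big_seq1 //.
  exact/setIidPl.
have sNZi : N \subset ('Z('chi_i))%CF.
  apply/subsetP=> x Nx; rewrite irr_cfcenterE ?(subsetP sNG) //.
  rewrite -(cfResE _ sNG Nx) -(cfRes1 N) resE2 !cfunE normrM normC_lin_char //.
  rewrite lin_char1 // !mulr1 ger0_norm //.
  by rewrite natr_ge0 // Cnat_cfdot_char_irr ?cfRes_char ?irr_char.
have sRK : ([~: N, G] \subset cfker 'chi_i)%g.
  have nK := normal_norm (cfker_normal 'chi_i).
  rewrite -quotient_cents2 ?(subset_trans sNG) //.
  rewrite (subset_trans (quotientS _ sNZi)) //.
  by rewrite (subset_trans (cfcenter_subset_center _)) ?subsetIr.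
have NK1 : (N :&: cfker 'chi_i = 1)%g.
  apply: contraNeq nker => ntNK.
  have /= := min (N :&: cfker 'chi_i)%G; rewrite ntNK normsI ?(normal_norm (cfker_normal _)) //.
  by rewrite subsetIl => /(_ isT isT) <-; rewrite subsetIr.
rewrite subsetI sNG; apply/commG1P/trivgP; rewrite -NK1 subsetI sRK andbT.
by rewrite commg_subl.
Qed.

Lemma minnormal_central_prime :
  prime p -> (p.-group N)%g -> minnormal N G -> N \subset ('Z(G))%g -> #|N| = p.
Proof.
move=> p_pr pN minN sNZ; have [/andP[ntN _] min] := mingroupP minN.
have [_ pdN _] := pgroup_pdiv pN ntN.
have [z Nz oz] := Cauchy p_pr pdN.
have sZN : <[z]>%g \subset N by rewrite cycle_subG.
rewrite -(min <[z]>%G) //= cycle_eq1 -order_gt1 oz prime_gt1 //=.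
rewrite cents_norm // (subset_trans _ (centS sZN)) //.
by rewrite centsC (subset_trans sNZ) ?subsetIr.
Qed.
End CentralKernel.

(** * Lifting elements of prime order modulo a normal subgroup of coprime order *)

Section Lifting.
Local Open Scope nat_scope.
Local Open Scope group_scope.
Variables (gT : finGroupType) (G R : {group gT}) (p : nat).
Hypotheses (nsRG : R <| G) (p_pr : prime p) (p'R : ~~ (p %| #|R|)).

Lemma p_subgroup_TI (A : {group gT}) : p.-group A -> A :&: R = 1.
Proof.
by move=> pA; apply: coprime_TIg; rewrite (pnat_coprime pA) // p'natE.
Qed.

Lemma lift_prime_order x : x \in G / R -> #[x] = p ->
  exists h, [/\ h \in G, coset R h = x & #[h] = p].
Proof.
case/morphimP=> g Ng Gg -> ox; exists g.`_p.
have Gh : g.`_p \in G by rewrite groupX.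
have imh : coset R g.`_p = coset R g.
  by rewrite morph_constt // constt_p_elt // /p_elt ox pnat_id.
split=> //; have ph : p.-group <[g.`_p]> by apply: p_elt_constt.
have sAG : <[g.`_p]> \subset G by rewrite cycle_subG.
rewrite orderE (card_sub_image nsRG sAG) (p_subgroup_TI ph) cards1 muln1.
by rewrite quotient_cycle ?(subsetP (normal_norm nsRG)) // imh -orderE.
Qed.

(** Conjugation by a preimage of g maps <[h]> to another Sylow p-subgroup of
    <[h]> <*> R; Sylow's theorem corrects it to normalize <[h]>, which meets R
    trivially. *)
Lemma lift_inverted h g : h \in G -> #[h] = p -> g \in G / R ->
  coset R h ^ g = (coset R h)^-1 -> exists2 k, k \in G & h ^ k = h^-1.
Proof.
move=> Gh oh; case/morphimP=> {}g Ng Gg -> inv.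
have nRG := subsetP (normal_norm nsRG).
have pA : p.-group <[h]> by rewrite /pgroup -orderE oh pnat_id.
have nRA : <[h]> \subset 'N(R) by rewrite cycle_subG nRG.
pose H := (<[h]> <*> R)%G.
have sHG : H \subset G by rewrite join_subG cycle_subG Gh normal_sub.
have cH : #|H| = (p * #|R|)%N.
  by rewrite /= norm_joinEl // TI_cardMg ?(p_subgroup_TI pA) // -orderE oh.
have cHp : (#|H|`_p)%N = p.
  rewrite cH (partnM _ (prime_gt0 p_pr) (cardG_gt0 R)) part_pnat_id ?pnat_id //.
  rewrite part_p'nat ?muln1 //.
  by rewrite p'natE.
have sylA : p.-Sylow(H) <[h]> by rewrite pHallE joing_subl cHp -orderE oh /=.
have hgH : h ^ g \in H.
  have : coset R (h ^ g) = coset R h^-1 by rewrite morphJ ?nRG // inv morphV ?nRG.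
  move/(rcoset_kercosetP (nRG _ (groupJ Gh Gg)) (nRG _ (groupVr Gh))).
  case/rcosetP=> r Rr ->; rewrite groupM //.
    by rewrite (subsetP (joing_subr _ _)).
  by rewrite groupV (subsetP (joing_subl _ _)) ?cycle_id.
have sylB : p.-Sylow(H) (<[h]> :^ g).
  by rewrite pHallE /= -cycleJ cycle_subG hgH cHp -orderE orderJ oh /=.
have [k Hk eAB] := Sylow_trans sylA sylB.
exists (g * k^-1); first by rewrite groupM // groupV (subsetP sHG).
have memA : h ^ (g * k^-1) \in <[h]>.
  by rewrite conjgM -mem_conjg -(eAB : <[h]> :^ g = <[h]> :^ k) memJ_conjg cycle_id.
have kA : coset R k \in <[coset R h]>.
  have : coset R k \in H / R by rewrite mem_quotient.
  by rewrite quotientYidr // quotient_cycle ?nRG.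
have Gk : k \in G := subsetP sHG k Hk.
have im : coset R (h ^ (g * k^-1)) = coset R h^-1.
  case/cycleP: (kA) => n Kn.
  rewrite conjgM !morphJ ?nRG ?groupJ ?groupV // inv !morphV ?nRG // /= Kn.
  apply/conjg_fixP/commgP/commuteV/commute_sym/commuteV/commute_sym.
  exact: commuteX.
have Ghk : h ^ (g * k^-1) \in G by rewrite groupJ ?groupM ?groupV.
have /(rcoset_kercosetP (nRG _ Ghk) (nRG _ (groupVr Gh)))/rcosetP[r Rr e] := im.
have : r \in <[h]> :&: R.
  by rewrite inE Rr andbT -(mulgK h^-1 r) -e groupM // invgK cycle_id.
by rewrite (p_subgroup_TI pA) => /set1P r1; rewrite e r1 mul1g.
Qed.

End Lifting.

(** * The three final cases *)

Lemma sum_cycle (gT : finGroupType) (V : nmodType) (F : gT -> V) (h : gT) n :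
  #[h]%g = n -> \sum_(a in <[h]>%g) F a = \sum_(k < n) F (h ^+ k)%g.
Proof.
move=> <-; pose f (k : 'I_#[h]%g) := (h ^+ k)%g.
have f_inj : injective f.
  move=> j k /eqP; rewrite eq_expg_mod_order !modn_small ?ltn_ord // => /eqP.
  exact: val_inj.
have -> : <[h]>%g = [set f k | k : 'I_#[h]%g].
  apply/setP=> a; apply/idP/imsetP => [/cyclePmin[k lt_k ->]|[k _ ->]].
    by exists (Ordinal lt_k).
  exact: mem_cycle.
by rewrite big_imset //= => j k _ _; apply: f_inj.
Qed.

Section EndGame.
Variables (gT : finGroupType) (G R : {group gT}) (X : pred (Iirr G)) (W : nat).
Hypothesis nsRG : (R <| G)%g.
Hypothesis class_bound : forall h, h \in G ->
  (\sum_(i | X i) `|'chi_i h| ^+ 2) * #|(coset R h ^: (G / R))%g|%:R <= W%:R.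
Hypotheses (simS : simple (G / R)) (nabS : ~~ abelian (G / R)).
Hypothesis big_defect : (14 * W < 15 * \sum_(i | X i) defect (irrdeg i))%N.

Lemma class_bound_ge m h : h \in G -> #|(coset R h ^: (G / R))%g| = m ->
  (\sum_(i | X i) `|'chi_i h| ^+ 2) * m%:R <= W%:R.
Proof. by move=> Gh <-; apply: class_bound. Qed.

Let big_order := class6_of_big_order nsRG class_bound simS nabS big_defect.
Let big_syl := class6_of_big_sylow5 nsRG class_bound simS nabS big_defect.
Let small5 := small_class_order5 nsRG class_bound big_defect.

Lemma quotient_card60 : #|(G / R)%g| = 60%N.
Proof. exact: card_simple_small_class5 simS nabS big_order big_syl small5. Qed.

Lemma quotient_cent5 x : x \in (G / R)%g -> #[x]%g = 5%N -> 'C_(G / R)[x]%g = <[x]>%g.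
Proof. exact: centralizer5 simS big_order big_syl x. Qed.

Lemma quotient_class5 x : x \in (G / R)%g -> #[x]%g = 5%N -> #|(x ^: (G / R))%g| = 12%N.
Proof.
move=> Sx ox; have := card_class5 simS big_order big_syl Sx ox.
by rewrite quotient_card60 => e; apply/eqP; rewrite -(@eqn_pmul2l 5) // -e.
Qed.

Lemma order_coset_prime p (h a : gT) : prime p -> #[h]%g = p -> h \in G ->
  a \in <[h]>%g -> a \notin R -> #[coset R a]%g = p.
Proof.
move=> p_pr oh Gh Aa nRa; have Ga : a \in G by move: a Aa {nRa}; apply/subsetP; rewrite cycle_subG.
have := coset_nontrivial nsRG Ga nRa; rewrite -order_eq1 => o1.
have : (#[coset R a]%g %| p)%N.
  rewrite -oh (dvdn_trans (morph_order _ _)) ?order_dvdG //.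
  exact: subsetP (normal_norm nsRG) a Ga.
by case/primeP: p_pr => _ /[apply]; rewrite (negPf o1) => /eqP.
Qed.

Lemma sum_by_degree (F : nat -> nat) (Y : pred (Iirr G)) :
  (\sum_(i | Y i && (irrdeg i <= 4)) F (irrdeg i)
    = F 1 * \sum_(i | Y i) (irrdeg i == 1) + F 2 * \sum_(i | Y i) (irrdeg i == 2)
    + F 3 * \sum_(i | Y i) (irrdeg i == 3) + F 4 * \sum_(i | Y i) (irrdeg i == 4))%N.
Proof.
rewrite big_mkcondr !big_distrr -!big_split /=; apply: eq_bigr => i _.
case: (irrdeg i) (irrdeg_gt0 i) => [|[|[|[|[|d]]]]] //= _;
  by rewrite ?muln0 ?muln1 ?addn0 ?add0n.
Qed.

(** If n_d is the number of characters of degree d, elements of order 5 (with 12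
    conjugates) give 4 n_1 + 6 n_2 + 6 n_3 + 4 n_4 <= 20.  Together with
    n_1 + 4 n_2 + 9 n_3 + 16 n_4 <= 60 and n_1 > 0 this rules out
    4 n_1 + 12 n_2 + 18 n_3 + 16 n_4 > 56 in natural numbers; A5 attains 56. *)
Lemma defect_simple : R :=: 1%g -> X =1 xpredT -> W = #|G| -> False.
Proof.
move=> R1 XT WG.
have cG : #|G| = 60%N by rewrite -quotient_card60 R1 -(card_isog (quotient1_isog G)).
have pr5 : prime 5 by [].
have d5 : (5 %| #|G|)%N by rewrite cG.
have [h Gh oh] := Cauchy pr5 d5.
have sAG : <[h]>%g \subset G by rewrite cycle_subG.
have TI : (<[h]> :&: R = 1)%g by rewrite R1 (setIidPr (sub1G _)).
have cA : #|<[h]>%g| = (5 * #|<[h]> :&: R|%g)%N by rewrite TI cards1 -orderE oh.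
have lin i : X i -> (irrdeg i <= 4)%N ->
    forall j, j \in irr_constt ('Res[<[h]>%g] 'chi_i) -> 'chi_j \is a linear_char.
  by move=> _ _ j; apply: cyclic_linear.
have big a : a \in <[h]>%g :\: R -> (12 <= #|(coset R a ^: (G / R))%g|)%N.
  case/setDP=> Aa nRa; have Ga := subsetP sAG a Aa.
  by rewrite quotient_class5 ?mem_quotient // (order_coset_prime pr5 oh Gh Aa).
have := weighted_count nsRG class_bound sAG cA isT lin big.
rewrite (sum_by_degree (fun d => d * (5 - d))%N) WG cG /=.
have := sum_defect_le4 X; have := big_defect; rewrite WG cG => bd eD; rewrite eD in bd.
move: bd; rewrite (sum_by_degree defect) /=.
have sq : (\sum_(i | X i && (irrdeg i <= 4)) irrdeg i ^ 2 <= 60)%N.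
  rewrite -cG -sum_irrdeg_sq [leqRHS](bigID (fun i => X i && (irrdeg i <= 4)%N)) /=.
  exact: leq_addr.
move: sq; rewrite (sum_by_degree (fun d => d ^ 2)%N).
have n1 : (0 < \sum_(i | X i) (irrdeg i == 1))%N.
  rewrite (bigD1 (0 : Iirr G)) ?XT //= [irrdeg 0](_ : _ = 1%N) //.
  by apply/eqP; rewrite -eqC_nat -irrdegE irr0 cfun1E group1.
move: n1; rewrite /defect; clear.
do 4!move: (\sum_(i | X i) _)%N => ?.
lia.
Qed.

(** The norm of the restriction to <[h]> is an integer N with
    3 N = d ^ 2 + 2 |chi(h)| ^ 2, so 2 |chi(h)| ^ 2 is a natural number congruent
    to 2 modulo 3. *)
Lemma order3_value (h : gT) (i : Iirr G) :
  h \in G -> #[h]%g = 3%N -> ~~ (3 %| irrdeg i)%N -> 1 <= `|'chi_i h| ^+ 2.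
Proof.
move=> Gh oh n3; have sAG : <[h]>%g \subset G by rewrite cycle_subG.
have := restriction_norm_sum i sAG.
have /natrP[N ->] : '['Res[<[h]>%g] 'chi_i] \in Num.nat.
  by rewrite Cnat_cfdot_char // cfRes_char ?irr_char.
rewrite (sum_cycle _ oh) -orderE oh !big_ord_recl big_ord0 /= addr0 expg0 expg1.
have -> : (h ^+ 2 = h^-1)%g.
  by apply/eqP; rewrite -(inj_eq (mulgI h)) mulgV -expgS -oh expg_order.
rewrite irr_inv norm_conjC irrdegE normr_nat => e.
set t := `|_| ^+ 2 in e *.
have t0 : 0 <= t by rewrite exprn_ge0.
have d3N : (irrdeg i ^ 2 <= 3 * N)%N.
  by rewrite -(ler_nat algC) natrX natrM -e lerDl addr_ge0.
have d_mod : (irrdeg i ^ 2 %% 3 = 1)%N.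
  rewrite -modnXm; move: n3; rewrite /dvdn.
  by case: (_ %% 3)%N (ltn_pmod (irrdeg i) (isT : 0 < 3)%N) => [|[|[|]]].
have {d3N d_mod} gap : (irrdeg i ^ 2 + 2 <= 3 * N)%N.
  move: d3N; rewrite (divn_eq (irrdeg i ^ 2) 3) d_mod; clear; lia.
rewrite -(@ler_pMn2r _ 2) // [t *+ 2]mulr2n -(lerD2l ((irrdeg i)%:R ^+ 2)) e.
by rewrite -natrX -natrD -natrM ler_nat.
Qed.

(** By [order3_value], and as elements of order 3 have 20 conjugates in G / R, there
    are at most W / 20 characters of degree 2 or 4; their defects are 12 and 16. *)
Lemma defect_even : ~~ (3 %| #|R|)%N ->
  (forall i, X i -> (irrdeg i <= 4)%N -> (2 %| irrdeg i)%N) -> False.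
Proof.
move=> n3R even.
have pr3 : prime 3 by [].
have d3 : (3 %| #|(G / R)%g|)%N by rewrite quotient_card60.
have [y Sy oy] := Cauchy pr3 d3.
have [h [Gh hy oh]] := lift_prime_order nsRG pr3 n3R Sy oy.
have cy : #|(coset R h ^: (G / R))%g| = 20%N.
  by rewrite hy; apply: card_class3 simS nabS quotient_card60 y Sy oy.
have := class_bound_ge Gh cy.
pose n := (\sum_(i | X i && (irrdeg i <= 4)) 1)%N => bd.
have le_n : (n * 20 <= W)%N.
  rewrite -(ler_nat algC); apply: le_trans bd; rewrite natrM ler_wpM2r ?ler0n //.
  rewrite natr_sum [leRHS](bigID (fun i => irrdeg i <= 4)%N) /= ler_wpDr //.
    by apply: sumr_ge0 => i _; rewrite exprn_ge0 ?normr_ge0.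
  apply: ler_sum => i /andP[Xi d4]; apply: order3_value => //.
  by have := even i Xi d4; case: (irrdeg i) d4 (irrdeg_gt0 i) => [|[|[|[|[|]]]]].
have le_Phi : (\sum_(i | X i) defect (irrdeg i) <= 16 * n)%N.
  rewrite sum_defect_le4 big_distrr /=; apply: leq_sum => i /andP[Xi d4].
  by have := even i Xi d4; case: (irrdeg i) d4 (irrdeg_gt0 i) => [|[|[|[|[|]]]]].
by move: big_defect le_n le_Phi; clear; move: (\sum_(i | _) _)%N => P; lia.
Qed.

(** As h is conjugate to its inverse, s = chi(h) and s' = chi(h ^+ 2) are real, and
    the norm M of the restriction of chi to <[h]> and the multiplicity m of the
    trivial character in it satisfy 5 M = 9 + 2 s ^ 2 + 2 s' ^ 2 and
    5 m = 3 + 2 s + 2 s'.  Hence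
    4 (s - s') ^ 2 = 20 M - 36 - (5 m - 3) ^ 2, where M >= m ^ 2 + (3 - m) and
    m < 3, and this is at least 15 + 5 m (2 - m). *)
Lemma order5_difference (h : gT) (i : Iirr G) :
    h \in G -> #[h]%g = 5%N -> (exists2 k, k \in G & h ^ k = h^-1)%g ->
    irrdeg i = 3%N -> h \notin cfker 'chi_i ->
  15 <= 4 * `|'chi_i h - 'chi_i (h ^+ 2)%g| ^+ 2.
Proof.
move=> Gh oh [k Gk hk] d3 nker; have sAG : <[h]>%g \subset G by rewrite cycle_subG.
set s := 'chi_i h; set s' := 'chi_i (h ^+ 2)%g.
have chV j : 'chi_i (h ^+ j)%g = 'chi_i ((h ^+ j)^-1)%g.
  by rewrite -(cfunJ _ _ Gk) conjXg hk expgVn.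
have h4 : (h ^+ 4 = h^-1)%g.
  by apply/eqP; rewrite -(inj_eq (mulgI h)) mulgV -expgS -oh expg_order.
have h3 : (h ^+ 3 = (h ^+ 2)^-1)%g.
  apply/eqP; rewrite -(inj_eq (mulgI (h ^+ 2)%g)) mulgV -expgD.
  by rewrite (_ : (2 + 3)%N = #[h]%g) ?expg_order ?oh.
have sR : s^* = s by rewrite /s -irr_inv -[h in RHS]expg1 chV expg1.
have s'R : s'^* = s' by rewrite /s' -irr_inv -chV.
have chi4 : 'chi_i (h ^+ 4)%g = s by rewrite h4 irr_inv sR.
have chi3 : 'chi_i (h ^+ 3)%g = s' by rewrite h3 irr_inv s'R.
have chi1 : 'chi_i 1%g = 3 by rewrite irrdegE d3.
set phi := 'Res[<[h]>%g] 'chi_i.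
have Nphi : phi \is a character by rewrite cfRes_char ?irr_char.
pose m j := Num.truncn '[phi, 'chi_j].
have mE j : '[phi, 'chi_j] = (m j)%:R by rewrite truncnK ?Cnat_cfdot_char_irr.
have sum_m : (\sum_j m j = 3)%N.
  apply/eqP; rewrite -eqC_nat natr_sum -chi1 -(cfRes1 <[h]>%g 'chi_i) -/phi.
  rewrite [phi]cfun_sum_cfdot sum_cfunE; apply/eqP/eq_bigr => j _.
  by rewrite cfunE (lin_char1 (irr_cyclic_lin j (cycle_cyclic h))) mulr1 mE.
have norm_m : '[phi] = (\sum_j m j ^ 2)%N%:R.
  rewrite cfdot_sum_irr natr_sum; apply: eq_bigr => j _.
  by rewrite mE conjC_nat natrX expr2.
have e1 : 9 + 2 * s ^+ 2 + 2 * s' ^+ 2 = 5 * (\sum_j m j ^ 2)%N%:R.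
  have := restriction_norm_sum i sAG; rewrite -/phi norm_m (sum_cycle _ oh) -orderE oh => <-.
  rewrite !big_ord_recl big_ord0 /= expg0 expg1 chi1 chi3 chi4 -/s -/s'.
  by rewrite !normCK sR s'R conjC_nat; ring.
have e2 : 3 + 2 * s + 2 * s' = 5 * (m 0)%:R.
  rewrite -mE irr0 cfdotE -orderE oh mulVKf ?pnatr_eq0 //.
  rewrite (eq_bigr (fun a => 'chi_i a)) => [|a Aa]; last first.
    by rewrite cfResE // cfun1E Aa conjC1 mulr1.
  rewrite (sum_cycle _ oh) !big_ord_recl big_ord0 /= expg0 expg1 chi1 chi3 chi4.
  by rewrite -/s -/s'; ring.
have m0_lt3 : (m 0%R < 3)%N.
  rewrite ltnNge; apply/negP=> m0_ge3.
  have := sum_m; rewrite (bigD1 0) //= => e.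
  have m0E : m 0%R = 3%N by apply/eqP; rewrite eqn_leq m0_ge3 andbT -[X in (_ <= X)%N]e leq_addr.
  rewrite m0E -[RHS]addn0 in e; have rest0 := addnI e.
  move/eqP: rest0; rewrite sum_nat_eq0 => /forall_inP rest0.
  case/negP: nker; rewrite cfkerEirr inE chi1 -(cfResE _ sAG (cycle_id h)) -/phi.
  rewrite [phi]cfun_sum_cfdot sum_cfunE (bigD1 0) //= big1 => [|j /rest0/eqP mj0].
    by rewrite addr0 cfunE mE m0E irr0 cfun1E cycle_id mulr1.
  by rewrite cfunE mE mj0 mul0r.
have le_sq : (m 0%R ^ 2 + (3 - m 0%R) <= \sum_j m j ^ 2)%N.
  rewrite -sum_m (bigD1 0) //= [leqRHS](bigD1 0) //= addKn leq_add2l.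
  by apply: leq_sum => j _; case: (m j) => // n; rewrite expnS leq_pmulr.
rewrite normCK rmorphB /= sR s'R.
have -> : 4 * ((s - s') * (s - s')) = 4 * (9 + 2 * s ^+ 2 + 2 * s' ^+ 2)
   - (3 + 2 * s + 2 * s') ^+ 2 + 6 * (3 + 2 * s + 2 * s') - 45 by ring.
rewrite e1 e2 -(lerD2r (45 + (5 * (m 0)%:R) ^+ 2)).
rewrite [leRHS](_ : _ = 20 * (\sum_j m j ^ 2)%N%:R + 30 * (m 0)%:R); last by ring.
rewrite -!(natrM, natrX, natrD) ler_nat.
move: (\sum_j m j ^ 2)%N (m 0%R) le_sq m0_lt3 => N [|[|[|]]] //; clear; lia.
Qed.

Lemma sum_norm_difference (h g : gT) :
    \sum_(i | X i) 'chi_i h * ('chi_i g)^* = 0 ->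
  \sum_(i | X i) `|'chi_i h - 'chi_i g| ^+ 2
    = \sum_(i | X i) `|'chi_i h| ^+ 2 + \sum_(i | X i) `|'chi_i g| ^+ 2.
Proof.
move=> hg; have gh : \sum_(i | X i) ('chi_i h)^* * 'chi_i g = 0.
  apply: (can_inj conjCK); rewrite conjC0 -[RHS]hg rmorph_sum.
  by apply: eq_bigr => i _; rewrite rmorphM /= conjCK.
transitivity (\sum_(i | X i) (`|'chi_i h| ^+ 2 + `|'chi_i g| ^+ 2)
   - \sum_(i | X i) 'chi_i h * ('chi_i g)^* - \sum_(i | X i) ('chi_i h)^* * 'chi_i g).
  by rewrite -!sumrB; apply: eq_bigr => i _; rewrite !normCK rmorphB /=; ring.
by rewrite hg gh !subr0 big_split.
Qed.

(** Elements h and h ^+ 2 have 12 conjugates each in G / R and are not conjugate, so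
    the sum over X of |chi(h) - chi(h ^+ 2)| ^ 2 is at most W / 6.  By
    [order5_difference] there are at most 2 W / 45 characters of degree 3, each of
    defect 18. *)
Lemma defect_three : ~~ (5 %| #|R|)%N ->
    (forall i, X i -> (irrdeg i <= 4)%N -> irrdeg i = 3%N) ->
    (forall i h, X i -> h \in G -> h \notin R -> h \notin cfker 'chi_i) ->
    (forall h g, h \in G -> g \in G -> coset R h \notin (coset R g ^: (G / R))%g ->
      \sum_(i | X i) 'chi_i h * ('chi_i g)^* = 0) -> False.
Proof.
move=> n5R three faith cross.
have pr5 : prime 5 by [].
have d5 : (5 %| #|(G / R)%g|)%N by rewrite quotient_card60.
have [x Sx ox] := Cauchy pr5 d5.
have [h [Gh hx oh]] := lift_prime_order nsRG pr5 n5R Sx ox.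
have [[g Sg xg] x2] := order5_inverted simS quotient_card60 quotient_cent5 Sx ox.
have Nh : h \in ('N(R))%g := subsetP (normal_norm nsRG) h Gh.
have nRh : h \notin R.
  by apply/negP=> Rh; rewrite -hx coset_id // order1 in ox.
have inv : (exists2 k, k \in G & h ^ k = h^-1)%g.
  by apply: (lift_inverted nsRG pr5 n5R Gh oh Sg); rewrite hx.
have ch : #|(coset R h ^: (G / R))%g| = 12%N by rewrite hx quotient_class5.
have ch2 : #|(coset R (h ^+ 2)%g ^: (G / R))%g| = 12%N.
  by rewrite quotient_class5 ?mem_quotient ?groupX // morphX //= hx orderXgcd ox.
have nconj : coset R h \notin (coset R (h ^+ 2)%g ^: (G / R))%g.
  by rewrite class_sym morphX //= hx.
pose n := (\sum_(i | X i && (irrdeg i <= 4)) 1)%N.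
have lower : (15 * n)%N%:R <= 4 * \sum_(i | X i) `|'chi_i h - 'chi_i (h ^+ 2)%g| ^+ 2.
  rewrite big_distrr natr_sum mulr_sumr /= [leRHS](bigID (fun i => irrdeg i <= 4)%N) /=.
  rewrite ler_wpDr //.
    by apply: sumr_ge0 => i _; rewrite mulr_ge0 ?ler0n ?exprn_ge0.
  apply: ler_sum => i /andP[Xi d4]; rewrite muln1.
  exact: (order5_difference Gh oh inv (three i Xi d4) (faith i h Xi Gh nRh)).
have le_n : (45 * n <= 2 * W)%N.
  rewrite -(@leq_pmul2l 4) // -(ler_nat algC).
  rewrite (_ : (4 * (45 * n)) = 15 * n * 12)%N; last by clearbody n; clear; lia.
  rewrite natrM; apply: (@le_trans _ _ (4 * (W%:R + W%:R))); last first.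
    by rewrite -natrD -natrM ler_nat; clear; lia.
  have b1 := class_bound_ge Gh ch; have b2 := class_bound_ge (groupX 2 Gh) ch2.
  apply: le_trans (ler_wpM2l _ (lerD b1 b2)) => //.
  rewrite -mulrDl mulrA ler_wpM2r ?ler0n //.
  by rewrite -(sum_norm_difference (cross h _ Gh (groupX 2 Gh) nconj)).
have le_Phi : (\sum_(i | X i) defect (irrdeg i) <= 18 * n)%N.
  rewrite sum_defect_le4 big_distrr /=; apply: leq_sum => i /andP[Xi d4].
  by rewrite (three i Xi d4).
by move: big_defect le_n le_Phi; clear; move: (\sum_(i | _) _)%N => P; lia.
Qed.

End EndGame.

(** * The minimal counterexample *)

Section MinimalCounterexample.
Variables (gT : finGroupType) (G : {group gT}).
Hypothesis nsolG : ~~ solvable G.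
Hypothesis solP : forall H : {group gT}, H \proper G -> solvable H.
Hypothesis quotient_defect : forall N : {group gT}, (N <| G)%g -> N :!=: 1%g -> N \proper G ->
  (15 * total_defect (G / N)%g <= 14 * #|(G / N)%g|)%N.
Hypothesis big_defect : (14 * #|G| < 15 * total_defect G)%N.

Lemma perfect_minimal : (G^`(1) = G)%g.
Proof.
have [//|lt] := eqVproper (der_sub 1 G); case/negP: nsolG.
rewrite (series_sol (der_normal 1 G)) (solP (lt : (G^`(1))%G \proper G)) /=.
by rewrite abelian_sol // sub_der1_abelian.
Qed.

Section Radical.
Variable R : {group gT}.
Hypothesis maxR : maxnormal R G G.

Let nsRG : (R <| G)%g := maxnormal_normal maxR.
Let ltRG : R \proper G := maxnormal_proper maxR.
Let simS : simple (G / R).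
Proof. by rewrite quotient_simple. Qed.

Lemma quotient_nonsolvable (N : {group gT}) : (N <| G)%g -> N \proper G -> ~~ solvable (G / N).
Proof. by move=> nsNG ltNG; apply: contra nsolG => sol; rewrite (series_sol nsNG) solP. Qed.

Let nabS : ~~ abelian (G / R).
Proof. by apply: contra (quotient_nonsolvable nsRG ltRG); apply: abelian_sol. Qed.

(** By the Frattini argument the normalizer of P covers G / R, so it cannot be a
    proper, hence solvable, subgroup. *)
Lemma sylow_radical_normal (p : nat) (P : {group gT}) :
  (p.-Sylow(R) P)%g -> (P <| G)%g.
Proof.
move=> sylP; have sPG := subset_trans (pHall_sub sylP) (normal_sub nsRG).
have FG := Frattini_arg nsRG sylP.
rewrite /normal sPG; have [/setIidPl //|ltN] := eqVproper (subsetIl G 'N(P)%g).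
case/negP: (quotient_nonsolvable nsRG ltRG).
rewrite -[X in solvable (X / _)]FG quotientMidl.
by rewrite quotient_sol // (solP (ltN : 'N_G(P)%G \proper G)).
Qed.

(** The kernel of chi is proper, hence solvable, so its image in the simple group
    G / R is trivial. *)
Lemma notin_cfker (N : {group gT}) (i : Iirr G) h :
  ~~ (N \subset cfker 'chi_i) -> N \subset R -> h \in G -> h \notin R -> h \notin cfker 'chi_i.
Proof.
move=> nker sNR Gh nRh; apply: contra nRh => Kh.
have nsK := cfker_normal 'chi_i.
have ltK : cfker_group 'chi_i \proper G.
  rewrite properEneq normal_sub // andbT; apply: contraNneq nker => ->.
  by rewrite (subset_trans sNR) ?normal_sub.
have := normal_in_simple simS (quotient_normal R nsK).
case=> [K1|KS]; last first.
  case/negP: (quotient_nonsolvable nsRG ltRG).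
  by rewrite -(KS : (cfker 'chi_i / R = G / R)%g) quotient_sol // (solP ltK).
have sKN : cfker 'chi_i \subset ('N(R))%g.
  by rewrite (subset_trans (normal_sub nsK)) ?normal_norm.
have : cfker 'chi_i \subset R by rewrite -quotient_sub1 // (K1 : (cfker 'chi_i / R = 1)%g).
by move/subsetP; apply.
Qed.

Section Layer.
Variable N : {group gT}.
Hypotheses (nsNG : (N <| G)%g) (ntN : N :!=: 1%g) (sNR : N \subset R).

Let X : pred (Iirr G) := fun i => ~~ (N \subset cfker 'chi_i).
Let W := (\sum_(i | X i) irrdeg i ^ 2)%N.

Let ltNG : N \proper G := sub_proper_trans sNR ltRG.

(** The bound holds for G / N and fails for G, so it fails for the characters
    that are nontrivial on N. *)
Lemma layer_big_defect : (14 * W < 15 * \sum_(i | X i) defect (irrdeg i))%N.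
Proof.
have := quotient_defect nsNG ntN ltNG; have := big_defect.
rewrite (total_defect_split nsNG) [X in (14 * X < _)%N](sum_irrdeg_sq_split nsNG).
rewrite -/X -/W !mulnDr => lt le; rewrite -(ltn_add2l (14 * #|(G / N)%g|)).
by apply: leq_trans lt _; rewrite leq_add2r.
Qed.

(** Nonconjugate images in G / R stay nonconjugate in G and in G / N, so the full
    column sums vanish in both groups, and X is the difference. *)
Lemma layer_orthogonal h g : h \in G -> g \in G ->
    coset R h \notin (coset R g ^: (G / R))%g ->
  \sum_(i | X i) 'chi_i h * ('chi_i g)^* = 0.
Proof.
move=> Gh Gg nconj.
have nconjN : coset N h \notin (coset N g ^: (G / N))%g.
  apply: contra nconj; rewrite !class_coset // => /imsetP[u gu eNu].
  have Gu : u \in G by apply: subsetP gu; rewrite class_subG.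
  apply/imsetP; exists u => //; have nNG := subsetP (normal_norm nsNG).
  have /rcosetP[z Nz ->] : h \in (N :* u)%g by apply/rcoset_kercosetP; rewrite ?nNG.
  have nRG := subsetP (normal_norm nsRG).
  by rewrite mkerl ?ker_coset ?nRG // (subsetP sNR).
have nconjG : h \notin (g ^: G)%g.
  by apply: contra nconj => hg; rewrite class_coset // imset_f.
have := second_orthogonality_relation h Gg; rewrite (negPf nconjG) mulr0n.
rewrite (bigID (fun i => N \subset cfker 'chi_i)) /= big_irr_quo //.
rewrite (eq_bigr (fun i : Iirr (G / N)%g => 'chi_i (coset N h) * ('chi_i (coset N g))^*)).
  by rewrite second_orthogonality_relation ?mem_quotient // (negPf nconjN) mulr0n add0r.
by move=> i _; rewrite mod_IirrE // !cfModE.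
Qed.

Lemma layer_class_bound h : h \in G ->
  (\sum_(i | X i) `|'chi_i h| ^+ 2) * #|(coset R h ^: (G / R))%g|%:R <= W%:R.
Proof. exact: sum_norm_irr_class_diff. Qed.
End Layer.

(** A minimal normal subgroup N inside the Sylow p-subgroup of R.  The failing bound
    provides a character of degree at most 4 that is nontrivial on N, whence N is
    central of order p, and p divides that degree. *)
Lemma central_layer (p : nat) : prime p -> (p %| #|R|)%N ->
  exists N : {group gT}, [/\ (N <| G)%g, N :!=: 1%g, N \subset R, (p <= 3)%N
    & forall i, ~~ (N \subset cfker 'chi[G]_i) -> (p %| irrdeg i)%N].
Proof.
move=> p_pr pR; have [P sylP] := Sylow_exists p R.
have ntP : P :!=: 1%g.
  by rewrite -cardG_gt1 (card_Hall sylP) p_part_gt1 mem_primes p_pr cardG_gt0.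
have nsPG := sylow_radical_normal sylP.
have [N minN sNP] := minnormal_exists ntP (normal_norm nsPG).
have [/andP[ntN nNG] _] := mingroupP minN.
have sNR := subset_trans sNP (pHall_sub sylP).
have ltNG := sub_proper_trans sNR ltRG.
have nsNG : (N <| G)%g by rewrite /normal proper_sub.
have pN : (p.-group N)%g := pgroupS sNP (pHall_pgroup sylP).
have [i Xi d4] : exists2 i : Iirr G, ~~ (N \subset cfker 'chi_i) & (irrdeg i <= 4)%N.
  apply/exists_inP; apply: contraT; rewrite negb_exists_in => /forall_inP no.
  have := layer_big_defect nsNG ntN sNR; rewrite [X in (_ < 15 * X)%N]big1 ?muln0 //.
  by move=> i /no; rewrite -ltnNge /defect => /eqP->.
have sNZ := minnormal_faithful_small_degree nsolG solP minN ltNG d4 Xi.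
have cN := minnormal_central_prime p_pr pN minN sNZ.
have dvd j : ~~ (N \subset cfker 'chi[G]_j) -> (p %| irrdeg j)%N.
  exact: prime_dvd_degree perfect_minimal sNZ cN p_pr.
exists N; split=> //.
have := dvdn_leq (irrdeg_gt0 i) (dvd i Xi); move: p_pr d4; clear.
by case: (irrdeg i) => [|[|[|[|[|]]]]] //; case: p => [|[|[|[|[|]]]]].
Qed.

Lemma minimal_counterexample_absurd : False.
Proof.
have [R1|ntR] := eqVneq R 1%G.
  have bound h (Gh : h \in G) := sum_norm_irr_class nsRG Gh.
  apply: (@defect_simple _ G R xpredT #|G|) => //; first by rewrite R1.
have [p p_pr pR] : exists2 p, prime p & (p %| #|R|)%N.
  by exists (pdiv #|R|); rewrite ?pdiv_prime ?pdiv_dvd ?cardG_gt1.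
have n5R : ~~ (5 %| #|R|)%N.
  by apply/negP=> /(central_layer (isT : prime 5))[N []].
have [d3|n3R] := boolP (3 %| #|R|)%N.
  have [N [nsNG ntN sNR _ dvd]] := central_layer (isT : prime 3) d3.
  apply: (defect_three nsRG (layer_class_bound nsNG sNR) simS nabS
    (layer_big_defect nsNG ntN sNR) n5R).
  - move=> i Xi d4; have := dvd i Xi.
    by case: (irrdeg i) d4 (irrdeg_gt0 i) => [|[|[|[|[|]]]]].
  - by move=> i h Xi Gh nRh; apply: notin_cfker Xi sNR Gh nRh.
  - by move=> h g; apply: layer_orthogonal.
have [N [nsNG ntN sNR p3 dvd]] := central_layer p_pr pR.
have p2 : p = 2%N.
  by case: p p_pr p3 pR {dvd} => [|[|[|[|]]]] // _ _ d3; rewrite d3 in n3R.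
apply: (defect_even nsRG (layer_class_bound nsNG sNR) simS nabS
    (layer_big_defect nsNG ntN sNR) n3R).
by move=> i Xi _; rewrite -p2; apply: dvd.
Qed.

End Radical.
End MinimalCounterexample.

Lemma total_defect_nonsolvable (n : nat) : forall (gT : finGroupType) (G : {group gT}),
  (#|G| <= n)%N -> ~~ solvable G -> (15 * total_defect G <= 14 * #|G|)%N.
Proof.
elim: n => [|n IH] gT G leGn nsolG; first by rewrite leqNgt cardG_gt0 in leGn.
rewrite leqNgt; apply/negP=> big.
have solP (H : {group gT}) : H \proper G -> solvable H.
  move=> ltH; apply: contraLR big => nsolH; rewrite -leqNgt.
  have leH : (#|H| <= n)%N by rewrite -ltnS (leq_trans (proper_card ltH)).
  have sHG := proper_sub ltH.
  rewrite (leq_trans (leq_mul (leqnn 15) (total_defect_sub sHG))) //.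
  by rewrite mulnCA -(Lagrange sHG) [leqRHS]mulnA [leqRHS]mulnC leq_mul2l (IH _ H) ?orbT.
have quo (N : {group gT}) : (N <| G)%g -> N :!=: 1%g -> N \proper G ->
    (15 * total_defect (G / N)%g <= 14 * #|(G / N)%g|)%N.
  move=> nsNG ntN ltN; apply: IH.
    by rewrite -ltnS (leq_trans (ltn_quotient ntN (normal_sub nsNG))).
  by apply: contra nsolG => sol; rewrite (series_sol nsNG) solP.
have ntG : G :!=: 1%g by apply: contraNneq nsolG => ->; apply: solvable1.
have [R maxR] := ex_maxnormal_ntrivg ntG.
exact: minimal_counterexample_absurd nsolG solP quo big R maxR.
Qed.

Theorem theorem1p5 (gT : finGroupType) (G : {group gT})
  (hAD : AD G < 61 / 15) : solvable G.
Proof.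
apply: contraT => nsolG; have := AD_lt_total_defect hAD.
by rewrite ltnNge (total_defect_nonsolvable (leqnn _) nsolG).
Qed.
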